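(* Let $\mathcal{V}_h\subset\mathcal{V}$ and $\mathcal{Q}_h\subset\mathcal{Q}$ be finite dimensional subspaces, let $\mathcal{K}_h:=\{v\in\mathcal{V}_h: b(v,q)=0\ \forall q\in\mathcal{Q}_h\}$, and assume there are constants $\alpha_*^0,\beta_*>0$, independent of $h$, such that $$a(v_0,v_0)\ge\alpha_*^0\|v_0\|_{\mathcal{V}}^2\quad\forall v_0\in\mathcal{K}_h,\qquad \inf_{0\ne q\in\mathcal{Q}_h}\ \sup_{0\ne v\in\mathcal{V}_h}\frac{b(v,q)}{\|v\|_{\mathcal{V}}\|q\|_{\mathcal{Q}}}\ge\beta_*.$$ Let $f\in L^1(\mathcal{J};\mathcal{V}')$, $g\in L^1(\mathcal{J};\mathcal{Q}')$; assume that the continuous problem (see context) has a unique solution $(u,p)\in L^1(\mathcal{J};\mathcal{V}\times\mathcal{Q})$, and let $(u_h,p_h)\in L^1(\mathcal{J};\mathcal{V}_h\times\mathcal{Q}_h)$ be the unique solution of the semi-discrete problem (see context). Assume also that the dual regularity hypothesis stated in the context holds. Then there is a constant $C$, independent of $h$, such that $$\begin{aligned}&\|u-u_h\|_{L^1(\mathcal{J};\mathcal{V}_-)}+\|p-p_h\|_{L^1(\mathcal{J};\mathcal{Q}_-)}\\&\quad\le C\Big(\inf_{v\in L^1(\mathcal{J};\mathcal{V}_h)}\|u-v\|_{L^1(\mathcal{J};\mathcal{V})}+\inf_{q\in L^1(\mathcal{J};\mathcal{Q}_h)}\|p-q\|_{L^1(\mathcal{J};\mathcal{Q})}\Big)\big(r(h)+n(h)\big),\end{aligned}$$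 where $$r(h):=\sup_{0\ne w\in L^\infty(\mathcal{J};\mathcal{V}_{++})}\ \inf_{w_h\in L^\infty(\mathcal{J};\mathcal{V}_h)}\frac{\|w-w_h\|_{L^\infty(\mathcal{J};\mathcal{V})}}{\|w\|_{L^\infty(\mathcal{J};\mathcal{V}_{++})}},\qquad n(h):=\sup_{0\ne m\in L^\infty(\mathcal{J};\mathcal{Q}_{++})}\ \inf_{m_h\in L^\infty(\mathcal{J};\mathcal{Q}_h)}\frac{\|m-m_h\|_{L^\infty(\mathcal{J};\mathcal{Q})}}{\|m\|_{L^\infty(\mathcal{J};\mathcal{Q}_{++})}}.$$ Moreover, if $r(h)+n(h)\le C'h$ for some constant $C'$ independent of $h$, then there is a constant $C$ independent of $h$ such that $$\|u-u_h\|_{L^1(\mathcal{J};\mathcal{V}_-)}+\|p-p_h\|_{L^1(\mathcal{J};\mathcal{Q}_-)}\le Ch\Big(\inf_{v\in L^1(\mathcal{J};\mathcal{V}_h)}\|u-v\|_{L^1(\mathcal{J};\mathcal{V})}+\inf_{q\in L^1(\mathcal{J};\mathcal{Q}_h)}\|p-q\|_{L^1(\mathcal{J};\mathcal{Q})}\Big).$$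
   Context: $\mathcal{V}$ and $\mathcal{Q}$ are real Hilbert spaces with duals $\mathcal{V}',\mathcal{Q}'$; $\langle\cdot,\cdot\rangle_{\mathcal{V}}$, $\langle\cdot,\cdot\rangle_{\mathcal{Q}}$ are the duality pairings. $\mathcal{J}=[0,T]$ with $T\in[0,\infty)$; $L^1(\mathcal{J};X)$, $L^\infty(\mathcal{J};X)$ are Bochner spaces. The real-valued kernels $k_1,k_2,k_3$ are continuous and bounded on $\{(t,s):0\le s\le t\le T\}$, with $|k_i(t,s)|\le C_{k_i}$. $a:\mathcal{V}\times\mathcal{V}\to\mathbb{R}$ is a symmetric, positive semi-definite, continuous bilinear form; $b:\mathcal{V}\times\mathcal{Q}\to\mathbb{R}$ is a continuous bilinear form; there is $\alpha_0>0$ with $a(v_0,v_0)\ge\alpha_0\|v_0\|_{\mathcal{V}}^2$ for all $v_0\in\mathcal{K}=\{v\in\mathcal{V}: b(v,q)=0\ \forall q\in\mathcal{Q}\}$. Continuous problem: find $(u,p)\in L^1(\mathcal{J};\mathcal{V}\times\mathcal{Q})$ such that, for a.e. $t\in\mathcal{J}$ and all $(v,q)\in\mathcal{V}\times\mathcal{Q}$, $$\begin{aligned} a(u(t),v)+b(v,p(t))&=\langle f(t),v\rangle_{\mathcal{V}}+\int_0^t\big[k_1(t,s)a(u(s),v)+k_2(t,s)b(v,p(s))\big]ds,\\ b(u(t),q)&=\langle g(t),q\rangle_{\mathcal{Q}}+\int_0^t k_3(t,s)b(u(s),q)\,ds.\end{aligned}$$ Semi-discrete problem: find $(u_h,p_h)\in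 L^1(\mathcal{J};\mathcal{V}_h\times\mathcal{Q}_h)$ satisfying the same two equations (same $f,g$) with $(u,p)$ replaced by $(u_h,p_h)$, for a.e. $t$ and all $(v,q)\in\mathcal{V}_h\times\mathcal{Q}_h$. The index $h$ labels a family of such pairs of subspaces. Auxiliary spaces: $\mathcal{V}_-,\mathcal{Q}_-$ are Hilbert spaces with dense continuous inclusions $\mathcal{V}\hookrightarrow\mathcal{V}_-$, $\mathcal{Q}\hookrightarrow\mathcal{Q}_-$. Put $\mathcal{V}_+':=(\mathcal{V}_-)'$ and $\mathcal{Q}_+':=(\mathcal{Q}_-)'$, so that $\mathcal{V}_+'\hookrightarrow\mathcal{V}'$ and $\mathcal{Q}_+'\hookrightarrow\mathcal{Q}'$. $\mathcal{V}_{++}\hookrightarrow\mathcal{V}$ and $\mathcal{Q}_{++}\hookrightarrow\mathcal{Q}$ are (more regular) continuously included spaces. Dual regularity hypothesis: for any $\tau\in\mathcal{J}$ and any $(f_+,g_+)\in L^\infty([0,\tau];\mathcal{V}_+'\times\mathcal{Q}_+')$, the solution $(w,m)$ of the dual backward problem $$\begin{aligned} a(v,w(t))+b(v,m(t))&=\langle f_+(t),v\rangle_{\mathcal{V}_+'\times\mathcal{V}}+\int_t^\tau\big[k_1(s,t)a(v,w(s))+k_2(s,t)b(v,m(s))\big]ds,\\ b(w(t),q)&=\langle g_+(t),q\rangle_{\mathcal{Q}_+'\times\mathcal{Q}}+\int_t^\tau k_3(s,t)b(w(s),q)\,ds,\end{aligned}$$ for all $(v,q)\in\mathcal{V}\times\mathcal{Q}$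 and a.e. $t\in[0,\tau]$, belongs to $L^\infty([0,\tau];\mathcal{V}_{++}\times\mathcal{Q}_{++})$, and there is a constant $\widehat C$, independent of $f_+$ and $g_+$, such that $$\|w\|_{L^\infty([0,\tau];\mathcal{V}_{++})}+\|m\|_{L^\infty([0,\tau];\mathcal{Q}_{++})}\le\widehat C\big(\|f_+\|_{L^\infty([0,\tau];\mathcal{V}_+')}+\|g_+\|_{L^\infty([0,\tau];\mathcal{Q}_+')}\big).$$ *)

(* Defs.v *)
From HB Require Import structures.
From mathcomp Require Import all_boot all_order all_algebra.
From mathcomp Require Import all_classical all_reals all_analysis.

Set Implicit Arguments.
Unset Strict Implicit.
Unset Printing Implicit Defensive.

Import Order.TTheory GRing.Theory Num.Theory.
Import numFieldNormedType.Exports.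

Local Open Scope classical_set_scope.
Local Open Scope ring_scope.

(** A real Hilbert space is a complete normed space whose norm comes from a
    symmetric positive definite form. *)
Definition is_hilbert (R : realType) (X : completeNormedModType R) : Prop :=
  exists ip : {dot X for idfun}, forall x : X, `|x| ^+ 2 = ip x x.

(** * The topological dual, normed by
    [`|phi| = sup {`|phi x| : `|x| <= 1}] *)
Section Dual.
Context (R : realType) (X : normedModType R).

Definition cont_linear_pred : {pred X -> R^o} :=
  mem [set phi : X -> R^o | linear phi /\ continuous phi].

Fact cont_linear_submod_closed : submod_closed cont_linear_pred.
Proof.
split.
  rewrite inE; split; last by move=> x; exact: cst_continuous.
  by move=> c x y; rewrite /= scaler0 addr0.
move=> c phi psi; rewrite !inE => -[lphi cphi] [lpsi cpsi]; split.
  move=> d x y; rewrite !fctE lphi lpsi !scalerDr !scalerA (mulrC c d).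
  by rewrite addrACA.
move=> x; apply: (@cvgD _ R^o); last exact: cpsi.
by apply: (@cvgZl_tmp _ R^o); exact: cphi.
Qed.

HB.instance Definition _ := GRing.isSubmodClosed.Build _ _ cont_linear_pred
  cont_linear_submod_closed.

Record dual := Dual {
  dual_fun :> X -> R^o ;
  dual_funP : dual_fun \in cont_linear_pred }.

HB.instance Definition _ := [isSub for dual_fun].
HB.instance Definition _ := [Choice of dual by <:].
HB.instance Definition _ := [SubChoice_isSubLmodule of dual by <:].

Lemma dual_linear (phi : dual) : linear phi.
Proof. by have := dual_funP phi; rewrite inE => -[]. Qed.

Lemma dual_continuous (phi : dual) : continuous phi.
Proof. by have := dual_funP phi; rewrite inE => -[]. Qed.

HB.instance Definition _ (phi : dual) :=
  GRing.isLinear.Build R X R^o *:%R (dual_fun phi) (dual_linear phi).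

Lemma dual_bounded (phi : dual) : exists M : R, forall x, `|phi x| <= M * `|x|.
Proof.
have /linear_boundedP : bounded_near phi (nbhs (0 : X)).
  exact: continuous_linear_bounded (@dual_continuous phi 0).
case=> M [_ hM]; exists (M + 1) => x; apply: hM.
by rewrite ltrDl.
Qed.

Definition dual_ball_image (phi : dual) : set R :=
  [set `|phi x| | x in [set x : X | `|x| <= 1]].

Definition dual_norm (phi : dual) : R := sup (dual_ball_image phi).

Lemma dual_ball_image_has_sup (phi : dual) : has_sup (dual_ball_image phi).
Proof.
split; first by exists `|phi 0|; exists 0 => //=; rewrite normr0.
have [M hM] := dual_bounded phi; exists `|M| => _ [x /= x1 <-].
rewrite (le_trans (hM x))// (le_trans (ler_wpM2r _ (ler_norm M)))//.
by rewrite ler_piMr.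
Qed.

Lemma dual_norm_ub (phi : dual) (x : X) : `|x| <= 1 -> `|phi x| <= dual_norm phi.
Proof.
move=> x1; apply: (ub_le_sup (dual_ball_image_has_sup phi).2).
by exists x.
Qed.

Lemma dual_norm_le (phi : dual) (c : R) :
  (forall x, `|x| <= 1 -> `|phi x| <= c) -> dual_norm phi <= c.
Proof.
move=> h; apply: ge_sup; first exact: (dual_ball_image_has_sup phi).1.
by move=> _ [x /= x1 <-]; exact: h.
Qed.

Lemma dual_normD (phi psi : dual) :
  dual_norm (phi + psi) <= dual_norm phi + dual_norm psi.
Proof.
apply: dual_norm_le => x x1; rewrite (le_trans (ler_normD (phi x) (psi x)))//.
by rewrite lerD// dual_norm_ub.
Qed.

Lemma dual_normZ_le (c : R) (phi : dual) :
  dual_norm (c *: phi) <= `|c| * dual_norm phi.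
Proof.
apply: dual_norm_le => x x1; rewrite -[_ x]/(c * phi x) normrM.
by rewrite ler_wpM2l// dual_norm_ub.
Qed.

Lemma dual_normZ (c : R) (phi : dual) :
  dual_norm (c *: phi) = `|c| * dual_norm phi.
Proof.
apply/eqP; rewrite eq_le dual_normZ_le /=.
have [->|c0] := eqVneq c 0.
  rewrite normr0 mul0r (le_trans _ (dual_norm_ub (x := 0) _ _))//.
  by rewrite normr0.
rewrite -ler_pdivlMl ?normr_gt0// -normfV (le_trans _ (dual_normZ_le _ _))//.
by rewrite scalerA mulVf// scale1r.
Qed.

Lemma dual_norm0_eq0 (phi : dual) : dual_norm phi = 0 -> phi = 0.
Proof.
move=> phi0; apply/val_inj/funext => x /=.
have [->|x0] := eqVneq x 0; first by rewrite linear0.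
have nx0 : `|x| != 0 by rewrite normr_eq0.
have : `|phi (`|x|^-1 *: x)| <= 0.
  by rewrite -phi0 dual_norm_ub// normrZ normfV normr_id mulVf.
rewrite normr_le0 linearZ /= scaler_eq0 invr_eq0 (negbTE nx0) /=.
by move/eqP.
Qed.

HB.instance Definition _ := @Lmodule_isNormed.Build R dual dual_norm
  dual_normD dual_normZ dual_norm0_eq0.

End Dual.

(** * Bochner spaces over a subset [D] of the real line
    Elements are represented by functions, equality in the space being
    equality almost everywhere on [D]. *)
Section Bochner.
Context (R : realType).
Local Notation mu := (@lebesgue_measure R).

Section Codomain.
Context (X : normedModType R).

Definition simple_on (D : set R) (s : R -> X) : Prop :=
  finite_set (s @` D) /\
  forall x : X, measurable (D `&` s @^-1` [set x]).

Definition strongly_measurable (D : set R) (f : R -> X) : Prop :=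
  exists s : nat -> R -> X, (forall n, simple_on D (s n)) /\
    {ae mu, forall t, D t -> s ^~ t @ \oo --> f t}.

Definition bochner_norm (p : \bar R) (D : set R) (f : R -> X) : \bar R :=
  Lnorm mu p (fun t => (`|f t| * \1_D t)%:E).

(** [Lp_bochner p D W] is L^p(D; W), for a subspace [W] of [X] that is closed
    (below, [W] is finite-dimensional or the whole space). *)
Definition Lp_bochner (p : \bar R) (D : set R) (W : set X) : set (R -> X) :=
  [set f | [/\ strongly_measurable D f, (bochner_norm p D f < +oo)%E &
               {ae mu, forall t, D t -> W (f t)}]].

Definition fin_dim_subspace (W : set X) : Prop :=
  exists (n : nat) (e : 'I_n -> X),
    W = [set \sum_(i < n) c i *: e i | c in [set: 'I_n -> R]].

Definition best_approx (D : set R) (W : set X) (u : R -> X) : \bar R :=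
  ereal_inf [set bochner_norm 1%:E D (fun t => u t - v t) |
             v in Lp_bochner 1%:E D W].

End Codomain.

Definition cont_embedding (X Y : normedModType R) (j : X -> Y) : Prop :=
  injective j /\ continuous j.

(** The supremum is taken in [0, +oo], so that it is 0 when there is no nonzero
    [w] (i.e. when [Xpp] is trivial or [D] is negligible). *)
Definition approx_rate (Xpp X : normedModType R) (j : Xpp -> X) (D : set R)
    (W : set X) : \bar R :=
  maxe 0%E (ereal_sup
    [set ereal_inf
       [set (bochner_norm +oo D (fun t => (j (w t) - wh t)%R)
             / bochner_norm +oo D w)%E | wh in Lp_bochner +oo%E D W] |
     w in [set w : R -> Xpp | Lp_bochner +oo%E D setT w /\
                              bochner_norm +oo%E D w <> 0%E]]).

End Bochner.

Section Problems.
Context (R : realType) (V Q : completeNormedModType R).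
Context (a : V -> V -> R) (b : V -> Q -> R) (k1 k2 k3 : R -> R -> R).
Local Notation mu := (@lebesgue_measure R).

Definition b_kernel (W : set V) (M : set Q) : set V :=
  [set v | W v /\ forall q, M q -> b v q = 0].

Definition inf_sup (W : set V) (M : set Q) : \bar R :=
  ereal_inf [set ereal_sup [set (b v q / (`|v| * `|q|))%:E |
                            v in [set v | W v /\ v <> 0]] |
             q in [set q | M q /\ q <> 0]].

Definition bounded_kernel (T C : R) (k : R -> R -> R) : Prop :=
  {within [set z : R * R | 0 <= z.2 <= z.1 /\ z.1 <= T],
     continuous (fun z : R * R => k z.1 z.2)} /\
  forall t s, 0 <= s -> s <= t -> t <= T -> `|k t s| <= C.

Definition primal_solution (T : R) (W : set V) (M : set Q)
    (f : R -> dual V) (g : R -> dual Q) (u : R -> V) (p : R -> Q) : Prop :=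
  [/\ Lp_bochner 1%:E `[0, T] W u, Lp_bochner 1%:E `[0, T] M p &
   {ae mu, forall t, t \in `[0, T] -> forall v q, W v -> M q ->
      a (u t) v + b v (p t) = f t v +
        \int[mu]_(s in `[0, t]) (k1 t s * a (u s) v + k2 t s * b v (p s))
      /\
      b (u t) q = g t q + \int[mu]_(s in `[0, t]) (k3 t s * b (u s) q)}].

Definition unique_primal_solution (T : R) (W : set V) (M : set Q)
    (f : R -> dual V) (g : R -> dual Q) (u : R -> V) (p : R -> Q) : Prop :=
  primal_solution T W M f g u p /\
  forall u' p', primal_solution T W M f g u' p' ->
    {ae mu, forall t, t \in `[0, T] -> u' t = u t /\ p' t = p t}.

Section DualProblem.
Context (Vm Qm : completeNormedModType R) (iV : V -> Vm) (iQ : Q -> Qm).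

Definition dual_solution (tau : R) (fp : R -> dual Vm) (gp : R -> dual Qm)
    (w : R -> V) (m : R -> Q) : Prop :=
  [/\ Lp_bochner 1%:E `[0, tau] setT w, Lp_bochner 1%:E `[0, tau] setT m &
   {ae mu, forall t, t \in `[0, tau] -> forall v q,
      a v (w t) + b v (m t) = fp t (iV v) +
        \int[mu]_(s in `[t, tau]) (k1 s t * a v (w s) + k2 s t * b v (m s))
      /\
      b (w t) q = gp t (iQ q) + \int[mu]_(s in `[t, tau]) (k3 s t * b (w s) q)}].

(** The dual problem is solvable and each solution is regular; the estimate
    makes the solution unique, the problem being linear. *)
Definition dual_regularity (Vpp Qpp : completeNormedModType R)
    (jV : Vpp -> V) (jQ : Qpp -> Q) (T : R) : Prop :=
  forall tau, 0 <= tau <= T -> exists Chat : R,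
  forall (fp : R -> dual Vm) (gp : R -> dual Qm),
    Lp_bochner +oo%E `[0, tau] setT fp -> Lp_bochner +oo%E `[0, tau] setT gp ->
    (exists w m, dual_solution tau fp gp w m) /\
    forall w m, dual_solution tau fp gp w m ->
    exists (wp : R -> Vpp) (mp : R -> Qpp),
      [/\ Lp_bochner +oo%E `[0, tau] setT wp,
          Lp_bochner +oo%E `[0, tau] setT mp,
          {ae mu, forall t, t \in `[0, tau] -> w t = jV (wp t) /\ m t = jQ (mp t)} &
          (bochner_norm +oo `[0%R, tau] wp + bochner_norm +oo `[0%R, tau] mp <=
           Chat%:E * (bochner_norm +oo `[0%R, tau] fp +
                      bochner_norm +oo `[0%R, tau] gp))%E].
End DualProblem.

End Problems.

(* Main.v *)
Require Import Defs.
From HB Require Import structures.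
From mathcomp Require Import all_boot all_order all_algebra.
From mathcomp Require Import all_classical all_reals all_analysis.
From mathcomp Require Import ess_sup_inf measurable_realfun ring lra.

Set Implicit Arguments.
Unset Strict Implicit.
Unset Printing Implicit Defensive.

Import Order.TTheory GRing.Theory Num.Theory.
Import numFieldNormedType.Exports.

Local Open Scope classical_set_scope.
Local Open Scope ring_scope.

(** Put [e = u - uh] and [eps = p - ph]. Subtracting the two problems gives, for
    almost every time [t] and all discrete [v] and [q],
      [a (e t) v + b v (eps t) = \int_0^t (k1 t s * a (e s) v + k2 t s * b v (eps s))]
    and [b (e t) q = \int_0^t k3 t s * b (e s) q]. For fixed [q] the second
    equation is a homogeneous Volterra equation, hence [b (e t) q = 0]
    ([constraint_error0]).

    Quasi-optimality in the energy norms: compare [e] and [eps] with the errors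
    [u - v] and [p - q] of arbitrary discrete functions. Brezzi's theorem, with
    constants depending only on the coercivity and inf-sup bounds
    ([discrete_stability]), estimates the discrete differences [uh - v] and
    [ph - q] at each time by [u - v], [p - q] and the memory of the error, and
    Gronwall's lemma removes the memory ([quasi_optimality]).

    The weaker norms are reached by the Aubin-Nitsche argument, applied at each
    time separately. If the data of the dual problem on [[0, T]] do not depend on
    time, then its memory terms tend to zero at the final time, so that the
    solution at times close to [T] solves, up to an arbitrarily small defect, the
    stationary adjoint problem [a v W + b v N = phi v], [b W q = gamma q], with
    [W] and [N] bounded in the regular spaces ([static_dual_regularity]). This
    passage to the limit also makes it immaterial that [k2] and [k3] stand in
    the dual problem in the same places as in the primal one, although
    transposition would exchange them. Constant-in-time functions also
    show that [r h] and [n h] bound the stationary approximation errors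
    ([approx_rate_elementary]). Taking for [phi] and [gamma] norming functionals
    of [iV (e t)] and [iQ (eps t)] and testing the error equation with
    approximations of [W] and [N] gives, with [C] independent of [h],
      [`|iV (e t)| + `|iQ (eps t)| <=
         C * (r h + n h) * (`|e t| + `|eps t| + \int_0^T (`|e s| + `|eps s|))
         + C * \int_0^t (`|iV (e s)| + `|iQ (eps s)|)]
    ([duality_at_time]); Gronwall's lemma again absorbs the last integral
    ([duality_estimate]), and quasi-optimality bounds the remaining one.

    A strongly measurable function is only an almost everywhere limit of simple
    functions, and the integrals are taken for the Borel sigma-algebra. The
    first two parts below replace such functions by everywhere limits of simple
    functions without changing any integral. *)

(** * Lebesgue integrals without Borel measurability *)

Section NonmeasurableIntegrals.
Context d (T : measurableType d) (R : realType).
Variable mu : {measure set T -> \bar R}.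
Import HBNNSimple.

(** The integral of a nonnegative function is a supremum over the simple functions
    below it, whether or not the function is measurable, and each of these can be
    set to zero on a null set. *)
Lemma ge0_integral_ae_le (D : set T) (f g : T -> \bar R) :
  (forall x, D x -> (0 <= f x)%E) -> (forall x, D x -> (0 <= g x)%E) ->
  {ae mu, forall x, D x -> (f x <= g x)%E} ->
  (\int[mu]_(x in D) f x <= \int[mu]_(x in D) g x)%E.
Proof.
move=> f0 g0 [N [mN muN0 fgN]]; rewrite !ge0_integralE//.
apply: ge_ereal_sup => _ [h /= hf <-].
pose h' := proj_nnsfun h (measurableC mN).
have h'E : sintegral mu h = sintegral mu h'.
  rewrite -!integralT_nnsfun [LHS](@ge0_negligible_integral _ _ _ _ _ N)//.
  - rewrite setTD integral_mkcond; apply: eq_integral => x _.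
    rewrite /h' /= mindicE /patch; case: ifP => xN.
      by rewrite mulr1.
    by rewrite mulr0.
  - by apply/measurable_EFinP; exact: measurable_funTS.
  - by move=> x _; rewrite lee_fin fun_ge0.
rewrite h'E; apply: ereal_sup_ubound; exists h' => //= x.
have := hf x; rewrite /h' /= mindicE /patch.
case: ifPn => Dx hx; last first.
  by rewrite lee_fin mulr_le0_ge0 // -lee_fin.
case: (boolP (x \in ~` N)) => xN; last by rewrite mulr0; exact/g0/set_mem.
rewrite mulr1 (le_trans hx)//; apply: contrapT => nfg.
by move: xN; rewrite inE; apply; apply: fgN => /= /(_ (set_mem Dx)).
Qed.

Lemma ge0_integral_ae_eq (D : set T) (f g : T -> \bar R) :
  (forall x, D x -> (0 <= f x)%E) -> (forall x, D x -> (0 <= g x)%E) ->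
  {ae mu, forall x, D x -> f x = g x} ->
  (\int[mu]_(x in D) f x = \int[mu]_(x in D) g x)%E.
Proof.
move=> f0 g0 fg; apply/eqP; rewrite eq_le; apply/andP; split.
- by apply: ge0_integral_ae_le => //; apply: filterS fg => x fg /fg ->.
- by apply: ge0_integral_ae_le => //; apply: filterS fg => x fg /fg ->.
Qed.

Lemma Rintegral_ae_eq (D : set T) (f g : T -> R) :
  {ae mu, forall x, D x -> f x = g x} ->
  \int[mu]_(x in D) f x = \int[mu]_(x in D) g x.
Proof.
move=> fg; rewrite /Rintegral integralE [in RHS]integralE; congr (fine (_ - _)%E).
- by apply: ge0_integral_ae_eq => //; apply: filterS fg => x fg Dx; rewrite !funeposE fg.
- by apply: ge0_integral_ae_eq => //; apply: filterS fg => x fg Dx; rewrite !funenegE fg.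
Qed.

(** The positive and negative parts of [f] have integrals between [0] and that of
    [g], hence so does the absolute value of their difference, for an arbitrary [f]. *)
Lemma normr_Rintegral_le (D : set T) (f g : T -> R) :
  (\int[mu]_(x in D) (g x)%:E < +oo)%E ->
  (forall x, D x -> 0 <= g x) ->
  {ae mu, forall x, D x -> `|f x| <= g x} ->
  `|\int[mu]_(x in D) f x| <= \int[mu]_(x in D) g x.
Proof.
move=> gfin g0 fg; rewrite /Rintegral integralE.
have fp : (\int[mu]_(x in D) (EFin \o f)^\+ x <= \int[mu]_(x in D) (g x)%:E)%E.
  apply: ge0_integral_ae_le => //.
  apply: filterS fg => x fg Dx; rewrite funeposE ge_max !lee_fin g0// andbT.
  by rewrite (le_trans (ler_norm _)) ?fg.
have fn : (\int[mu]_(x in D) (EFin \o f)^\- x <= \int[mu]_(x in D) (g x)%:E)%E.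
  apply: ge0_integral_ae_le => //.
  apply: filterS fg => x fg Dx; rewrite funenegE ge_max !lee_fin g0// andbT.
  by rewrite (le_trans (ler_norm _)) ?normrN ?fg.
have fp0 : (0 <= \int[mu]_(x in D) (EFin \o f)^\+ x)%E by exact: integral_ge0.
have fn0 : (0 <= \int[mu]_(x in D) (EFin \o f)^\- x)%E by exact: integral_ge0.
have gi0 : (0 <= \int[mu]_(x in D) (g x)%:E)%E.
  by apply: integral_ge0 => x Dx; rewrite lee_fin g0.
move: fp fn fp0 fn0 gi0 gfin.
case: (\int[mu]_(x in D) (g x)%:E)%E => // G.
case: (\int[mu]_(x in D) _)%E => // A; case: (\int[mu]_(x in D) _)%E => // B.
by rewrite !lee_fin /= => ? ? ? ? _ _; rewrite ler_norml; apply/andP; split; lra.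
Qed.

End NonmeasurableIntegrals.

(** * Everywhere limits of simple functions *)

Section SimpleLimits.
Context (R : realType).
Local Notation mu := (@lebesgue_measure R).

(** A strongly measurable function redefined on a null set, so that the simple
    functions converge to it at every point: its composites with continuous
    functions are Borel measurable. *)
Definition simple_limit (X : normedModType R) (D : set R) (f : R -> X) : Prop :=
  exists s : nat -> R -> X, (forall n, simple_on D (s n)) /\
    forall t, D t -> s ^~ t @ \oo --> f t.

Lemma simple_on_comp2 (X Y Z : normedModType R) (D : set R) (h : X -> Y -> Z)
    (s : R -> X) (s' : R -> Y) :
  simple_on D s -> simple_on D s' -> simple_on D (fun t => h (s t) (s' t)).
Proof.
move=> [fs ms] [fs' ms']; split.
  apply: (sub_finite_set (B := (fun z : X * Y => h z.1 z.2) @`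
    ((s @` D) `*` (s' @` D)))).
    move=> _ [t Dt <-]; exists (s t, s' t) => //; split; by exists t.
  exact/finite_image/finite_setX.
move=> z.
pose F := [set x : X * Y | ((s @` D) `*` (s' @` D)) x /\ h x.1 x.2 = z].
have -> : D `&` (fun t => h (s t) (s' t)) @^-1` [set z] =
  \bigcup_(x in F) ((D `&` s @^-1` [set x.1]) `&` (D `&` s' @^-1` [set x.2])).
  apply/seteqP; split=> t /=.
    move=> [Dt hz]; exists (s t, s' t) => //=; split => //=.
    by split; exists t.
  by move=> [[x y] [_ /= <-] [[Dt <-] [_ <-]]].
apply: fin_bigcup_measurable; last by move=> x _; exact: measurableI.
by apply: (@sub_finite_set _ _ ((s @` D) `*` (s' @` D))); [move=> x []|
  exact: finite_setX].
Qed.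

Lemma simple_limit_comp2 (X Y Z : normedModType R) (D : set R) (h : X -> Y -> Z)
    (f : R -> X) (g : R -> Y) :
  continuous (fun z : X * Y => h z.1 z.2) ->
  simple_limit D f -> simple_limit D g ->
  simple_limit D (fun t => h (f t) (g t)).
Proof.
move=> ch [s [ss sf]] [s' [ss' s'g]].
exists (fun n t => h (s n t) (s' n t)); split=> [n|t Dt].
  exact: simple_on_comp2.
have h_cvg : h z.1 z.2 @[z --> (f t, g t)] --> h (f t) (g t) by exact: (ch (f t, g t)).
exact: (continuous2_cvg _ h_cvg (sf t Dt) (s'g t Dt)).
Qed.

Lemma simple_limit_cst (X : normedModType R) (D : set R) (x : X) :
  measurable D -> simple_limit D (fun=> x).
Proof.
move=> mD; exists (fun _ _ => x); split=> [_|t _]; last exact: cvg_cst.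
split.
  apply: (sub_finite_set (B := [set x])) => //; by move=> _ [t _ <-].
move=> y; have [->|/eqP xy] := eqVneq x y.
  by rewrite (_ : _ @^-1` _ = setT) ?setIT//; apply/seteqP; split.
by rewrite (_ : _ @^-1` _ = set0) ?setI0//; apply/seteqP; split.
Qed.

Lemma simple_limit_comp (X Z : normedModType R) (D : set R) (h : X -> Z)
    (f : R -> X) :
  measurable D -> continuous h -> simple_limit D f ->
  simple_limit D (fun t => h (f t)).
Proof.
move=> mD ch sf; apply: (@simple_limit_comp2 X X Z D (fun x _ => h x) f f) => //.
by move=> z; apply: (@continuous_comp _ _ _ fst h); [exact: cvg_fst|exact: ch].
Qed.

Lemma simple_limitB (X : normedModType R) (D : set R) (f g : R -> X) :
  simple_limit D f -> simple_limit D g -> simple_limit D (fun t => f t - g t).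
Proof.
apply: (@simple_limit_comp2 X X X D (fun x y => x - y)) => z.
by apply: (@cvgB _ X); [exact: cvg_fst|exact: cvg_snd].
Qed.

Lemma simple_on_measurable (D : set R) (s : R -> R) :
  measurable D -> @simple_on R R^o D s -> measurable_fun D s.
Proof.
move=> mD [fs ms] _ Y mY.
have -> : D `&` s @^-1` Y = \bigcup_(x in (s @` D) `&` Y) (D `&` s @^-1` [set x]).
  apply/seteqP; split=> t /=.
    by move=> [Dt Yt]; exists (s t) => //; split=> //; exists t.
  by move=> [x [_ Yx] [Dt st]]; split=> //; rewrite /= st.
apply: fin_bigcup_measurable => //.
by apply: sub_finite_set fs => x [].
Qed.

Lemma simple_limit_measurable (D : set (measurableTypeR R))
    (f : measurableTypeR R -> R) :
  measurable D -> @simple_limit R^o D f -> measurable_fun D f.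
Proof.
move=> mD [s [ss sf]].
suff mf : measurable_fun (D : set R) (f : R -> R) by exact: mf.
apply: (measurable_fun_cvg (h := s)); last exact: sf.
by move=> n; exact: simple_on_measurable.
Qed.

(** The approximating functions are set to zero on the exceptional null set, which
    keeps them simple because that set is Borel. *)
Lemma strongly_measurable_simple_limit (X : normedModType R) (D : set R)
    (f : R -> X) :
  measurable D -> strongly_measurable D f ->
  exists f', simple_limit D f' /\ {ae mu, forall t, D t -> f' t = f t}.
Proof.
move=> mD [s [ss [N [mN muN0 sfN]]]].
pose off (x : R -> X) t := if t \in N then 0 else x t.
exists (off f); split; last first.
  exists N; split=> // t /= ft; apply: contrapT => Nt; apply: ft => _.
  by rewrite /off memNset.
exists (fun n => off (s n)); split=> [n|t Dt]; last first.
  rewrite /off; case: ifPn => [_|tN]; first exact: cvg_cst.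
  apply: contrapT => nst; move/negP : tN; apply; rewrite inE.
  by apply: sfN => /= /(_ Dt).
have [fs ms] := ss n; split.
  apply: (@sub_finite_set _ _ ((s n @` D) `|` [set 0])).
    by move=> _ [t Dt <-]; rewrite /off; case: ifPn => _; [right|left; exists t].
  by rewrite finite_setU; split=> //; exact: finite_set1.
move=> x.
have -> : D `&` off (s n) @^-1` [set x] =
    ((D `&` s n @^-1` [set x]) `\` N) `|` (D `&` N `&` [set t | 0 = x]).
  apply/seteqP; split=> t /=; rewrite /off.
    move=> [Dt]; case: ifPn => tN st; first by right; split=> //; split=> //; exact/set_mem.
    by left; split => //; move/mem_set; exact/negP.
  move=> [[[Dt st] tN]|[[Dt tN] x0]]; split=> //; first by rewrite memNset.
  by rewrite mem_set.
apply: measurableU; first exact: measurableD.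
apply: measurableI; first exact: measurableI.
have [->|/eqP x0] := eqVneq 0 x.
  by rewrite (_ : [set _ | _] = setT)//; apply/seteqP; split.
by rewrite (_ : [set _ | _] = set0)//; apply/seteqP; split.
Qed.

End SimpleLimits.

(** * Gronwall's lemma in L^1 *)

Section Gronwall.
Context (R : realType).
Local Notation mu := (@lebesgue_measure R).
Implicit Types (D : set (measurableTypeR R)) (f g y alpha : measurableTypeR R -> R).

Lemma ae_imp (P Q : R -> Prop) :
  (forall t, P t -> Q t) -> {ae mu, forall t, P t} -> {ae mu, forall t, Q t}.
Proof.
move=> PQ [N [mN N0 sN]]; exists N; split=> // t nQ.
by apply: sN => /= /PQ.
Qed.

Lemma ae_and (P Q : R -> Prop) :
  {ae mu, forall t, P t} -> {ae mu, forall t, Q t} ->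
  {ae mu, forall t, P t /\ Q t}.
Proof.
move=> hP hQ; have F := ae_filter_ringOfSetsType mu.
exact: (filterI hP hQ).
Qed.

Lemma integrable_lt_pinfty D g : measurable D ->
  mu.-integrable D (EFin \o g) -> (\int[mu]_(x in D) (g x)%:E < +oo)%E.
Proof.
by move=> mD ig; have := integrable_fin_num mD ig; rewrite fin_numElt => /andP[].
Qed.

Lemma ge0_Rintegral_ae_le D f g : measurable D ->
  mu.-integrable D (EFin \o g) -> (forall t, D t -> 0 <= f t) ->
  (forall t, D t -> 0 <= g t) -> {ae mu, forall t, D t -> f t <= g t} ->
  \int[mu]_(t in D) f t <= \int[mu]_(t in D) g t.
Proof.
move=> mD ig f0 g0 fg; apply: le_trans (ler_norm _) _.
apply: normr_Rintegral_le => //; first exact: integrable_lt_pinfty.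
by apply: ae_imp fg => t fg Dt; rewrite ger0_norm ?f0// fg.
Qed.

Lemma ge0_Rintegral_subset (A B : set (measurableTypeR R)) g :
  measurable A -> measurable B -> A `<=` B ->
  mu.-integrable B (EFin \o g) -> (forall t, B t -> 0 <= g t) ->
  \int[mu]_(t in A) g t <= \int[mu]_(t in B) g t.
Proof.
move=> mA mB AB ig g0; rewrite /Rintegral fine_le//.
- by apply: integrable_fin_num => //; exact: integrableS ig.
- exact: integrable_fin_num.
- by apply: ge0_subset_integral => //; exact: measurable_int ig.
Qed.

Lemma integrable_cst_itv (b1 b2 : bool) (x y c : R) :
  mu.-integrable [set` Interval (BSide b1 x) (BSide b2 y)] (EFin \o cst c).
Proof.
apply/integrableP; split; first by apply/measurable_EFinP.
rewrite [ltLHS](_ : _ = \int[mu]_(t in [set` Interval (BSide b1 x) (BSide b2 y)])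
   (cst `|c|%:E) t)%E//.
rewrite integral_cst//= lebesgue_measure_itv/=; case: ifP => _.
  by rewrite -EFinB -EFinM ltry.
by rewrite mule0 ltry.
Qed.

(** On a step so short that [C * (z - x) <= 1 / 2], the memory of the step itself
    is at most half of the integral of [y] over [[0, z]] and is absorbed. *)
Lemma gronwall_step (T C x z : R) y alpha :
  0 <= x -> x <= z -> z <= T -> 0 <= C -> C * (z - x) <= 2^-1 ->
  mu.-integrable `[0, T] (EFin \o y) -> mu.-integrable `[0, T] (EFin \o alpha) ->
  (forall t, `[0, T]%classic t -> 0 <= y t) ->
  (forall t, `[0, T]%classic t -> 0 <= alpha t) ->
  {ae mu, forall t, `[0, T]%classic t ->
     y t <= alpha t + C * \int[mu]_(s in `[0, t]) y s} ->
  \int[mu]_(t in `[0, z]) y t <=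
    2 * \int[mu]_(t in `[0, x]) y t + 2 * \int[mu]_(t in `[0, T]) alpha t.
Proof.
move=> x0 xz zT C0 Czx iy ia y0 a0 ya.
have sub0z : `[0, z] `<=` `[0, T]%classic by apply: subset_itvl; rewrite bnd_simp.
have subxz : `]x, z] `<=` `[0, T]%classic.
  by apply: subset_itv; rewrite bnd_simp.
have iyz : mu.-integrable `[0, z] (EFin \o y) by exact: integrableS iy.
set Y := \int[mu]_(t in `[0, z]) y t.
have Y0 : 0 <= Y by apply: Rintegral_ge0 => t /sub0z; exact: y0.
have <- : \int[mu]_(t in `[0, x]) y t + \int[mu]_(t in `]x, z]) y t = Y.
  by rewrite -(Rintegral_itvB (x := x) iyz) ?bnd_simp// addrC subrK.
have ic : mu.-integrable `]x, z] (EFin \o cst (C * Y)).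
  exact: integrable_cst_itv.
have iaxz : mu.-integrable `]x, z] (EFin \o alpha) by exact: integrableS ia.
have : \int[mu]_(t in `]x, z]) y t <= \int[mu]_(t in `]x, z]) (alpha t + C * Y).
  apply: ge0_Rintegral_ae_le => //.
  - by apply: eq_integrable (integrableD _ iaxz ic).
  - by move=> t /subxz; exact: y0.
  - by move=> t /subxz /a0 at0; rewrite addr_ge0// mulr_ge0.
  apply: ae_imp ya => t yat txz; have Dt := subxz _ txz.
  rewrite (le_trans (yat Dt))// lerD2l ler_wpM2l//.
  apply: ge0_Rintegral_subset => //; last by move=> s /sub0z; exact: y0.
  by apply: subset_itvl; rewrite bnd_simp; move: txz; rewrite /= in_itv /= => /andP[].
rewrite (RintegralD (f2 := cst (C * Y)))// Rintegral_cst//.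
have -> : fine (mu `]x, z]) = z - x.
  rewrite lebesgue_measure_itv/= lte_fin; case: ltP => //= zx.
  by apply/eqP; rewrite eq_sym subr_eq0 eq_le xz zx.
have : \int[mu]_(t in `]x, z]) alpha t <= \int[mu]_(t in `[0, T]) alpha t.
  exact: ge0_Rintegral_subset.
have : C * Y * (z - x) <= 2^-1 * Y by rewrite mulrAC ler_wpM2r.
have YE : Y = \int[mu]_(t in `[0, x]) y t + \int[mu]_(t in `]x, z]) y t.
  by rewrite -(Rintegral_itvB (x := x) iyz) ?bnd_simp// addrC subrK.
move: YE; set Yx := \int[mu]_(t in `[0, x]) y t; set Yxz := \int[mu]_(t in `]x, z]) y t.
by set A := Rintegral _ _ alpha; set A' := Rintegral _ _ alpha; lra.
Qed.

(** The constant counts the steps of [gronwall_step] that cover [[0, T]], and so it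
    does not depend on [y] and [alpha]. *)
Lemma gronwall (T C : R) : 0 <= T -> 0 <= C -> exists2 K : R, 0 <= K &
  forall y alpha,
  mu.-integrable `[0, T] (EFin \o y) -> mu.-integrable `[0, T] (EFin \o alpha) ->
  (forall t, `[0, T]%classic t -> 0 <= y t) ->
  (forall t, `[0, T]%classic t -> 0 <= alpha t) ->
  {ae mu, forall t, `[0, T]%classic t ->
     y t <= alpha t + C * \int[mu]_(s in `[0, t]) y s} ->
  \int[mu]_(t in `[0, T]) y t <= K * \int[mu]_(t in `[0, T]) alpha t.
Proof.
move=> T0 C0.
pose N := (Num.truncn (2 * C * T)).+1.
have N0 : 0 < N%:R :> R by rewrite ltr0n.
have CTN : C * (T / N%:R) <= 2^-1.
  rewrite mulrA ler_pdivrMr// ler_pdivlMl// mulrA ltW//.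
  by rewrite truncnS_gt.
have tau0 k : 0 <= T * (k%:R / N%:R) by rewrite !mulr_ge0 ?invr_ge0// ltW.
have tauT k : (k <= N)%N -> T * (k%:R / N%:R) <= T.
  by move=> kN; rewrite ler_piMr// ler_pdivrMr// mul1r ler_nat.
(* [2 ^+ k.+1 - 2] solves [c 0 = 0], [c k.+1 = 2 * c k + 2] *)
exists (2 ^+ N.+1) => [|y alpha iy ia y0 a0 ya]; first exact: exprn_ge0.
set A := \int[mu]_(t in `[0, T]) alpha t.
have A0 : 0 <= A by exact: Rintegral_ge0.
suff H k : (k <= N)%N ->
    \int[mu]_(t in `[0, (T * (k%:R / N%:R))%R]) y t <= (2 ^+ k.+1 - 2) * A.
  have := H N (leqnn _); rewrite divff ?gt_eqF// mulr1 => /le_trans; apply.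
  by rewrite ler_wpM2r// lerBlDr lerDl.
elim: k => [_|k IH kN].
  by rewrite mul0r mulr0 set_itv1 Rintegral_set1 expr1 subrr mul0r.
have tauS : T * (k.+1%:R / N%:R) - T * (k%:R / N%:R) = T / N%:R.
  by rewrite -mulrBr -mulrBl -natrB// subSnn mul1r.
have tauSk : T * (k%:R / N%:R) <= T * (k.+1%:R / N%:R).
  by rewrite -subr_ge0 tauS divr_ge0// ltW.
have CS : C * (T * (k.+1%:R / N%:R) - T * (k%:R / N%:R)) <= 2^-1 by rewrite tauS.
have := gronwall_step (tau0 k) tauSk (tauT _ kN) C0 CS iy ia y0 a0 ya.
move=> /le_trans; apply; rewrite -/A.
have := IH (ltnW kN); rewrite [2 ^+ k.+2]exprS.
set Y := Rintegral _ _ _ => hY.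
apply: (le_trans (lerD (ler_wpM2l _ hY) (lexx _))) => //.
by rewrite le_eqVlt; apply/orP; left; apply/eqP; ring.
Qed.

End Gronwall.

(** * Inner products *)

Section InnerProducts.
Context (R : realType).

Definition inner_product (X : normedModType R) (ip : X -> X -> R) : Prop :=
  [/\ forall x y, ip x y = ip y x,
      forall y, scalar (ip ^~ y) &
      forall x, ip x x = `|x| ^+ 2].

Lemma is_hilbert_inner_product (X : completeNormedModType R) :
  is_hilbert X -> exists ip, @inner_product X ip.
Proof.
move=> [ip ipE]; exists (fun x y => ip x y); split=> [x y|y c x x'|x].
- by rewrite hermC expr0 mul1r.
- by rewrite linearPl.
- by rewrite ipE.
Qed.

Context (X : normedModType R) (ip : X -> X -> R) (hip : inner_product ip).

Lemma inner_sym x y : ip x y = ip y x. Proof. by case: hip. Qed.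

Lemma inner_norm x : ip x x = `|x| ^+ 2. Proof. by case: hip. Qed.

Lemma innerPl c x x' y : ip (c *: x + x') y = c * ip x y + ip x' y.
Proof. by case: hip => _ /(_ y c x x'). Qed.

Lemma innerPr c x y y' : ip x (c *: y + y') = c * ip x y + ip x y'.
Proof. by rewrite inner_sym innerPl !(inner_sym x). Qed.

Lemma innerDl x x' y : ip (x + x') y = ip x y + ip x' y.
Proof. by rewrite -[x]scale1r innerPl mul1r scale1r. Qed.

Lemma inner0l y : ip 0 y = 0.
Proof.
have := innerDl 0 0 y; rewrite addr0 => /eqP.
by rewrite addrC -subr_eq subrr eq_sym => /eqP.
Qed.

Lemma innerZl c x y : ip (c *: x) y = c * ip x y.
Proof. by rewrite -[c *: x]addr0 innerPl inner0l addr0. Qed.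

Lemma innerBl x x' y : ip (x - x') y = ip x y - ip x' y.
Proof. by rewrite -scaleN1r innerDl innerZl mulN1r. Qed.

Lemma inner_suml n (c : 'I_n -> R) (e : 'I_n -> X) y :
  ip (\sum_(i < n) c i *: e i) y = \sum_(i < n) c i * ip (e i) y.
Proof.
elim: n c e => [|n IH] c e; first by rewrite !big_ord0 inner0l.
by rewrite !big_ord_recl innerPl IH.
Qed.

Lemma inner_sumr n (c : 'I_n -> R) (e : 'I_n -> X) x :
  ip x (\sum_(i < n) c i *: e i) = \sum_(i < n) c i * ip x (e i).
Proof.
by rewrite inner_sym inner_suml; apply: eq_bigr => i _; rewrite inner_sym.
Qed.

Lemma cauchy_schwarz x y : `|ip x y| <= `|x| * `|y|.
Proof.
have [->|y0] := eqVneq y 0.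
  by rewrite inner_sym inner0l !normr0 mulr0.
have ny : 0 < `|y| by rewrite normr_gt0.
pose k := ip x y / `|y| ^+ 2.
have := sqr_ge0 (`|x - k *: y|); rewrite -inner_norm.
have -> : ip (x - k *: y) (x - k *: y) = ip x x - 2 * k * ip x y + k ^+ 2 * ip y y.
  rewrite innerBl (inner_sym x) (inner_sym (k *: y)) !innerBl !innerZl.
  by rewrite !(inner_sym _ (k *: y)) !innerZl (inner_sym y x); ring.
rewrite !inner_norm (_ : _ + _ = (`|x| ^+ 2 * `|y| ^+ 2 - ip x y ^+ 2) / `|y| ^+ 2); last first.
  by rewrite /k; field; rewrite gt_eqF.
rewrite pmulr_lge0 ?invr_gt0 ?exprn_gt0// subr_ge0 -exprMn => h.
rewrite -(@ler_pXn2r _ 2)// ?nnegrE ?mulr_ge0//.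
by rewrite real_normK ?num_real.
Qed.

(** One Gram-Schmidt step per vector. The family may be linearly dependent, in
    which case the remainder [d] vanishes and the coefficient [s] is [0]. *)
Lemma finite_riesz n (e : 'I_n -> X) (l : X -> R) : scalar l ->
  exists c : 'I_n -> R, forall i, ip (\sum_(j < n) c j *: e j) (e i) = l (e i).
Proof.
elim: n e l => [|n IH] e l ll; first by exists (fun=> 0) => -[].
pose e' i := e (lift ord0 i).
have [c hc] := IH e' l ll.
have sip : scalar (ip (e ord0)) by move=> ? ? ?; exact: innerPr.
have [c0 hc0] := IH e' _ sip.
set r := \sum_(j < n) c j *: e' j in hc.
set r0 := \sum_(j < n) c0 j *: e' j in hc0.
pose d := e ord0 - r0.
have dperp i : ip d (e' i) = 0 by rewrite innerBl hc0 subrr.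
have lsum : l r0 = \sum_(j < n) c0 j * l (e' j).
  rewrite /r0; have l0 : l 0 = 0.
    by have := ll (-1) 0 0; rewrite scaler0 addr0 mulN1r addNr.
  elim: (n) (c0) (e') => [|m IHm] c1 e1; first by rewrite !big_ord0.
  by rewrite !big_ord_recl ll IHm.
pose s := (l (e ord0) - ip r (e ord0)) / `|d| ^+ 2.
exists (fun i => if unlift ord0 i is Some j then c j - s * c0 j else s).
have -> : \sum_(j < n.+1) (if unlift ord0 j is Some k then c k - s * c0 k else s)
    *: e j = s *: d + r.
  rewrite big_ord_recl unlift_none /d scalerBr -addrA; congr (_ + _).
  rewrite /r /r0 addrC scaler_sumr -sumrB; apply: eq_bigr => j _.
  by rewrite liftK scalerBl scalerA.
move=> i; case: (unliftP ord0 i) => [j ->|->].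
  by rewrite innerPl -/(e' j) dperp mulr0 add0r hc.
rewrite innerPl.
have dE : ip d (e ord0) = `|d| ^+ 2.
  rewrite -inner_norm {3}/d (inner_sym d (_ - _)) innerBl inner_suml.
  rewrite big1 => [|j _]; last by rewrite inner_sym dperp mulr0.
  by rewrite subr0 inner_sym.
rewrite dE; have [d0|d0] := eqVneq d 0; last first.
  by rewrite /s mulfVK ?subrK// expf_neq0// normr_eq0.
rewrite d0 normr0 expr0n mulr0 add0r.
have -> : e ord0 = r0 by apply/eqP; rewrite -subr_eq0; apply/eqP.
by rewrite lsum inner_sumr; apply: eq_bigr => j _; rewrite hc.
Qed.

End InnerProducts.

(** * Bounded maps and norming functionals *)

Section BoundedMaps.
Context (R : realType).

Lemma bilinear_bounded (X Y : normedModType R)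
    (b : {bilinear X -> Y -> R | *%R & *%R}) :
  continuous (fun z : X * Y => b z.1 z.2) ->
  exists2 C, 0 <= C & forall x y, `|b x y| <= C * `|x| * `|y|.
Proof.
move=> cb; have /cvgrPdist_lt /(_ 1 ltr01) := cb (0, 0).
move=> /nbhs_ballP [e /= e0 he].
have ballb x y : `|x| < e -> `|y| < e -> `|b x y| <= 1.
  move=> xe ye; have /= := he (x, y); rewrite linear0l sub0r normrN => h.
  by apply/ltW/h; split; rewrite /= -ball_normE /= sub0r normrN.
have e20 : 0 < e / 2 by rewrite divr_gt0.
have e2e : e / 2 < e by rewrite ltr_pdivrMr// ltr_pMr// ltr1n.
exists ((e / 2)^-1 ^+ 2) => [|x y]; first by rewrite exprn_ge0// invr_ge0 ltW.
have [->|x0] := eqVneq x 0; first by rewrite linear0l !normr0 mulr0 mul0r.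
have [->|y0] := eqVneq y 0; first by rewrite linear0r !normr0 mulr0.
have nx : 0 < `|x| by rewrite normr_gt0.
have ny : 0 < `|y| by rewrite normr_gt0.
have scale_lt (Z : normedModType R) (z : Z) : 0 < `|z| ->
    `|(e / 2 / `|z|) *: z| < e.
  by move=> nz; rewrite normrZ gtr0_norm ?divr_gt0// divfK// gt_eqF.
have := ballb _ _ (scale_lt _ x nx) (scale_lt _ y ny).
rewrite linearZl_LR linearZr_LR /= normrM [X in _ * X]normrM.
rewrite (gtr0_norm (divr_gt0 e20 nx)) (gtr0_norm (divr_gt0 e20 ny)).
move=> h; rewrite -ler_pdivrMr// -ler_pdivrMr//.
rewrite -(ler_pM2l (exprn_gt0 2 e20)) -exprMn divff ?gt_eqF// expr1n.
apply: le_trans h; rewrite le_eqVlt; apply/orP; left; apply/eqP; field.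
by rewrite !gt_eqF.
Qed.

Lemma linear_bounded (X Y : normedModType R) (l : {linear X -> Y}) :
  continuous l -> exists2 C, 0 <= C & forall x, `|l x| <= C * `|x|.
Proof.
move=> cl; have /linear_boundedP : bounded_near l (nbhs (0 : X)).
  exact: continuous_linear_bounded (cl 0).
case=> M [_ hM]; exists (`|M| + 1) => [|x]; first by rewrite addr_ge0.
by apply: hM; rewrite (le_lt_trans (ler_norm M))// ltrDl.
Qed.

Lemma dual_le_norm (X : normedModType R) (phi : dual X) (x : X) :
  `|phi x| <= `|phi| * `|x|.
Proof.
have [->|x0] := eqVneq x 0; first by rewrite linear0 !normr0 mulr0.
have nx : 0 < `|x| by rewrite normr_gt0.
have : `|phi (`|x|^-1 *: x)| <= `|phi|.
  apply: dual_norm_ub; rewrite normrZ gtr0_norm ?invr_gt0//.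
  by rewrite mulVf ?gt_eqF.
rewrite linearZ /= normrZ gtr0_norm ?invr_gt0//.
by rewrite ler_pdivrMl// mulrC.
Qed.

(** The Riesz representative of [x] divided by its norm. *)
Lemma norming_functional (X : completeNormedModType R) (x : X) :
  is_hilbert X -> exists phi : dual X, `|phi| <= 1 /\ phi x = `|x|.
Proof.
move=> /is_hilbert_inner_product[ip hip].
pose k := `|x|^-1.
pose l : X -> R^o := fun y => k * ip y x.
have ll : linear l.
  by move=> c y z; rewrite /l (innerPl hip) mulrDr mulrCA.
pose lM := GRing.isLinear.Build R X R^o *:%R l ll.
pose L : {linear X -> R^o} := HB.pack l lM.
have l1 y : `|l y| <= `|y|.
  rewrite /l normrM; have [x0|x0] := eqVneq x 0.
    by rewrite x0 (inner_sym hip) (inner0l hip) normr0 mulr0.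
  rewrite /k normfV normr_id ler_pdivrMl ?normr_gt0//.
  by rewrite (inner_sym hip) (cauchy_schwarz hip).
have cl : continuous l.
  apply: (@bounded_linear_continuous _ _ _ L); apply/linear_boundedP.
  exists 1; split; first exact: num_real.
  move=> r r1 y; apply: le_trans (l1 y) _.
  by rewrite ler_peMl// ltW.
have lP : l \in @cont_linear_pred R X by rewrite inE.
exists (Dual lP); split; first by apply: dual_norm_le => y y1; apply: le_trans (l1 y) y1.
rewrite /= /l (inner_norm hip) /k; have [->|x0] := eqVneq x 0.
  by rewrite normr0 expr0n mulr0.
by rewrite expr2 mulKf// normr_eq0.
Qed.

End BoundedMaps.

(** * Stability of the discrete saddle point problem *)

Section DiscreteStability.
Context (R : realType) (V Q : completeNormedModType R).
Context (a : {biscalar V}) (b : {bilinear V -> Q -> R | *%R & *%R}).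

Lemma fin_dim_subspaceP (X : normedModType R) (W : set X) :
  fin_dim_subspace W ->
  W 0 /\ forall c x y, W x -> W y -> W (c *: x + y).
Proof.
move=> [n [e ->]]; split.
  by exists (fun=> 0) => //; rewrite big1// => i _; rewrite scale0r.
move=> c _ _ [x _ <-] [y _ <-]; exists (fun i => c * x i + y i) => //.
by rewrite scaler_sumr -big_split; apply: eq_bigr => i _; rewrite scalerDl scalerA.
Qed.

Lemma fin_dim_subspaceB (X : normedModType R) (W : set X) x y :
  fin_dim_subspace W -> W x -> W y -> W (x - y).
Proof.
by move=> /fin_dim_subspaceP[_ WP] Wx Wy; rewrite addrC -scaleN1r; exact: WP.
Qed.

Lemma subspace_riesz ip (W : set V) (l : V -> R) : inner_product ip ->
  fin_dim_subspace W -> scalar l ->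
  exists2 r, W r & forall v, W v -> ip r v = l v.
Proof.
move=> hip [n [e ->]] ll; have [c hc] := finite_riesz hip e ll.
exists (\sum_(j < n) c j *: e j); first by exists c.
move=> _ [d _ <-]; rewrite (inner_sumr hip).
have l0 : l 0 = 0 by have := ll (-1) 0 0; rewrite scaler0 addr0 mulN1r addNr.
under eq_bigr do rewrite hc.
elim: (n) (e) (d) => [|m IHm] e1 d1; first by rewrite !big_ord0.
by rewrite !big_ord_recl ll IHm.
Qed.

(** The two conditions say that [x1] is the projection of [x] on the orthogonal
    complement of the discrete kernel; the point is that this complement
    consists of Riesz representatives of the functionals [b ^~ q]. *)
Lemma kernel_complement ip (Vh : set V) (Qh : set Q) (x : V) :
  inner_product ip -> fin_dim_subspace Vh -> fin_dim_subspace Qh -> Vh x ->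
  exists x1 q, [/\ Vh x1, Qh q, forall v, Vh v -> ip x1 v = b v q &
    forall q', Qh q' -> b (x - x1) q' = 0].
Proof.
move=> hip fV fQ Vx; have [m [f Qhf]] := fQ.
have /choice[r hr] : forall j, exists r, Vh r /\ forall v, Vh v -> ip r v = b v (f j).
  move=> j; have sb : scalar (fun v => b v (f j)) by move=> c u v; rewrite linearPl.
  by have [r Wr hr] := subspace_riesz hip fV sb; exists r.
have sx : scalar (ip x) by move=> ? ? ?; exact: (innerPr hip).
have [c hc] := finite_riesz hip r sx.
have Vsum d : Vh (\sum_(j < m) d j *: r j).
  have [V0 VP] := fin_dim_subspaceP fV.
  have hrV j : Vh (r j) := (hr j).1.
  elim: (m) (r) hrV d => [|k IH] r' hr' d; first by rewrite big_ord0.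
  by rewrite big_ord_recl; apply: VP; [exact: hr'|apply: IH => j; exact: hr'].
exists (\sum_(j < m) c j *: r j), (\sum_(j < m) c j *: f j); split.
- exact: Vsum.
- by rewrite Qhf; exists c.
- move=> v Vv; rewrite (inner_suml hip) linear_sumr; apply: eq_bigr => j _.
  by rewrite (hr j).2// linearZr_LR.
- rewrite Qhf => _ [d _ <-]; rewrite linear_sumr big1// => j _.
  rewrite linearZr_LR /= -(hr j).2; last exact: fin_dim_subspaceB.
  by rewrite (inner_sym hip) (innerBl hip) hc subrr mulr0.
Qed.

(** The form in which the inf-sup condition is used: a bound for [b ^~ q] on the
    discrete space is a bound for [q]. *)
Lemma inf_sup_bound (Vh : set V) (Qh : set Q) (beta c : R) (q : Q) :
  (beta%:E <= inf_sup b Vh Qh)%E -> Qh q -> 0 <= c ->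
  (forall v, Vh v -> `|b v q| <= c * `|v|) -> beta * `|q| <= c.
Proof.
move=> hb Qq c0 bc; have [->|q0] := eqVneq q 0; first by rewrite normr0 mulr0.
have nq : 0 < `|q| by rewrite normr_gt0.
rewrite -ler_pdivlMr// -lee_fin (le_trans hb)//.
apply: le_trans (ereal_inf_lbound _) _; first by exists q => //; split => //; exact/eqP.
apply: ge_ereal_sup => _ [v [Vv /eqP v0] <-]; rewrite lee_fin.
have nv : 0 < `|v| by rewrite normr_gt0.
rewrite invfM mulrA ler_pM2r ?invr_gt0// ler_pdivrMr//.
exact: le_trans (ler_norm _) (bc v Vv).
Qed.

(** Brezzi's theorem. Split [x] into [x1] of [kernel_complement], represented by
    some [q], and [x - x1] in the discrete kernel. As [`|x1| ^+ 2 = b x q], the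
    inf-sup condition bounds [x1] by [G]; coercivity then bounds [x - x1], and the
    first equation with the inf-sup condition bounds [y]. The constant is fixed
    before the subspaces, as it has to serve the whole family. *)
Lemma discrete_stability (Ca alpha beta : R) : 0 <= Ca -> 0 < alpha -> 0 < beta ->
  is_hilbert V -> (forall v w, `|a v w| <= Ca * `|v| * `|w|) ->
  exists2 K, 0 <= K & forall (Vh : set V) (Qh : set Q),
  fin_dim_subspace Vh -> fin_dim_subspace Qh ->
  (forall v, b_kernel b Vh Qh v -> alpha * `|v| ^+ 2 <= a v v) ->
  (beta%:E <= inf_sup b Vh Qh)%E ->
  forall x y F G, Vh x -> Qh y -> 0 <= F -> 0 <= G ->
  (forall v, Vh v -> `|a x v + b v y| <= F * `|v|) ->
  (forall q, Qh q -> `|b x q| <= G * `|q|) ->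
  `|x| + `|y| <= K * (F + G).
Proof.
move=> Ca0 al0 be0 hV aC; have [ip hip] := is_hilbert_inner_product hV.
pose k1 := (1 + Ca / beta) / alpha + beta^-1.
have k10 : 0 <= k1.
  by rewrite /k1 addr_ge0 ?invr_ge0 ?divr_ge0 ?addr_ge0 ?divr_ge0// ltW.
exists (k1 + (1 + Ca * k1) / beta).
  by rewrite addr_ge0// divr_ge0 ?addr_ge0 ?mulr_ge0// ltW.
move=> Vh Qh fV fQ acoer binfsup x y F G Vx Qy F0 G0 hF hG.
have [x1 [q [Vx1 Qq x1q bx1]]] := kernel_complement hip fV fQ Vx.
have Vx0 : Vh (x - x1) by exact: fin_dim_subspaceB.
have qx1 : beta * `|q| <= `|x1|.
  apply: (inf_sup_bound binfsup) => // v Vv.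
  by rewrite -x1q// (cauchy_schwarz hip).
have nx1 : `|x1| <= G / beta.
  have [->|x10] := eqVneq x1 0; first by rewrite normr0 divr_ge0// ltW.
  have n1 : 0 < `|x1| by rewrite normr_gt0.
  rewrite ler_pdivlMr// -(ler_pM2r n1) mulrAC -expr2 -(inner_norm hip) x1q//.
  have -> : b x1 q = b x q.
    by apply/eqP; rewrite eq_sym -subr_eq0 -linearBl bx1.
  rewrite mulrC (le_trans (ler_wpM2l (ltW be0) (le_trans (ler_norm _) (hG _ Qq))))//.
  by rewrite mulrCA ler_wpM2l.
have nx0 : `|x - x1| <= (F + Ca * (G / beta)) / alpha.
  have [->|x00] := eqVneq (x - x1) 0.
    by rewrite normr0 divr_ge0 ?addr_ge0 ?mulr_ge0 ?invr_ge0// ltW.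
  have n0 : 0 < `|x - x1| by rewrite normr_gt0.
  rewrite ler_pdivlMr// -(ler_pM2r n0) mulrAC -expr2 mulrC.
  apply: le_trans (acoer _ _) _; first by split.
  rewrite linearBl /= mulrDl lerD//.
    have := hF _ Vx0; rewrite bx1// addr0.
    exact: le_trans (ler_norm _).
  apply: le_trans (ler_norm _) _; rewrite normrN; apply: le_trans (aC _ _) _.
  by rewrite ler_wpM2r// ler_wpM2l.
have nx : `|x| <= k1 * (F + G).
  rewrite -[x](subrK x1) (le_trans (ler_normD _ _))// (le_trans (lerD nx0 nx1))//.
  rewrite -subr_ge0.
  have -> : k1 * (F + G) - ((F + Ca * (G / beta)) / alpha + G / beta) =
     Ca / beta / alpha * F + beta^-1 * F + alpha^-1 * G.
    by rewrite /k1; field; rewrite !gt_eqF.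
  by rewrite !addr_ge0 ?mulr_ge0 ?invr_ge0// ltW.
have ny : beta * `|y| <= F + Ca * `|x|.
  apply: (inf_sup_bound binfsup) => // [|v Vv]; first by rewrite addr_ge0// mulr_ge0.
  have -> : b v y = (a x v + b v y) - a x v by rewrite addrAC subrr add0r.
  by rewrite (le_trans (ler_normB _ _))// mulrDl lerD ?hF.
rewrite [leRHS]mulrDl lerD// mulrAC ler_pdivlMr// mulrC (le_trans ny)//.
rewrite mulrDl mul1r lerD ?lerDl// -mulrA ler_wpM2l//.
Qed.

End DiscreteStability.

(** * Bochner norms and approximation rates *)

Section BochnerNorms.
Context (R : realType).
Local Notation mu := (@lebesgue_measure R).

Lemma ae_exists (x y : R) (P : R -> Prop) : x < y ->
  {ae mu, forall t, P t} -> exists2 t, x <= t <= y & P t.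
Proof.
move=> xy [N [mN N0 sN]]; apply: contrapT => nP.
have sub : `[x, y]%classic `<=` N.
  move=> t /=; rewrite in_itv /= => txy; apply: sN => /= Pt.
  by apply: nP; exists t.
have : (mu `[x, y]%classic <= mu N)%E by apply: le_measure; rewrite ?inE.
rewrite N0 lebesgue_measure_itv /= lte_fin xy -EFinB lee_fin subr_le0.
by rewrite leNgt xy.
Qed.

Lemma lebesgue_measure_setT_gt0 : (0 < mu [set: R])%E.
Proof.
have : (mu `[0%R, 1%R]%classic <= mu [set: R])%E by apply: le_measure; rewrite ?inE.
by apply: lt_le_trans; rewrite lebesgue_measure_itv /= lte_fin ltr01 oppr0 adde0 lte_fin.
Qed.

Lemma bochner_normy_leP (X : normedModType R) (D : set R) (f : R -> X) (M : R) :
  0 <= M ->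
  (bochner_norm +oo D f <= M%:E)%E <-> {ae mu, forall t, D t -> `|f t| <= M}.
Proof.
move=> M0; rewrite /bochner_norm unlock lebesgue_measure_setT_gt0; split.
  move=> /ess_supP; apply: ae_imp => t /= + Dt.
  by rewrite indicE mem_set// mulr1 lee_fin normr_id.
move=> h; apply/ess_supP; apply: ae_imp h => t h /=; rewrite indicE lee_fin.
have [/set_mem Dt|_] := boolP (t \in D); last by rewrite mulr0 normr0.
by rewrite mulr1 normr_id h.
Qed.

Lemma bochner_normy_ge0 (X : normedModType R) (D : set R) (f : R -> X) :
  (0 <= bochner_norm +oo D f)%E.
Proof.
rewrite /bochner_norm unlock lebesgue_measure_setT_gt0.
apply: ess_sup_gee; first exact: lebesgue_measure_setT_gt0.
by apply: aeW => t /=; rewrite lee_fin.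
Qed.

Lemma cst_Lp_bochnery (X : normedModType R) (D : set R) (x : X) :
  measurable D -> Lp_bochner +oo%E D setT (fun=> x).
Proof.
move=> mD; split => //.
- have [s [ss sx]] := simple_limit_cst x mD.
  by exists s; split=> //; apply: aeW.
- apply: (@le_lt_trans _ _ (`|x|%:E)); last exact: ltry.
  by apply/bochner_normy_leP => //; apply: aeW.
- exact: aeW.
Qed.

Lemma bochner_normy_cst (X : normedModType R) (a b : R) (x : X) : a < b ->
  bochner_norm +oo `[a, b] (fun=> x) = `|x|%:E.
Proof.
move=> ab; apply/eqP; rewrite eq_le; apply/andP; split.
  by apply/bochner_normy_leP => //; apply: aeW.
have := bochner_normy_ge0 `[a, b] (fun=> x : X).
case E : (bochner_norm _ _ _) => [M| |] //; last by move=> _; rewrite leey.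
rewrite !lee_fin => M0.
have /bochner_normy_leP : (bochner_norm +oo `[a, b] (fun=> x : X) <= M%:E)%E.
  by rewrite E.
by move=> /(_ M0)/(ae_exists ab)[t abt]; apply; rewrite /= in_itv.
Qed.

Lemma integral_bochner_norm1 (X : normedModType R) (D : set R) (f f' : R -> X) :
  {ae mu, forall t, D t -> f' t = f t} ->
  bochner_norm 1%:E D f = (\int[mu]_(t in D) `|f' t|%:E)%E.
Proof.
move=> ff'; rewrite /bochner_norm Lnorm1 [RHS]integral_mkcond.
apply: ge0_integral_ae_eq => [t _|t _|]; first exact: abse_ge0.
  by rewrite /= /patch; case: ifP => // _; rewrite lee_fin.
apply: ae_imp ff' => t ff' _; rewrite /= /patch indicE.
case: ifPn => tD; last by rewrite mulr0 normr0.
by rewrite mulr1 normr_id ff'//; exact/set_mem.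
Qed.

(** A function constant in time competes in the supremum, and the values of its
    approximations at almost every time are approximations of its value. *)
Lemma approx_rate_elementary (Xpp X : normedModType R) (j : {linear Xpp -> X})
    (T rho delta : R) (W : set X) (w : Xpp) :
  0 < T -> W 0 -> 0 < delta ->
  (approx_rate j `[0%R, T] W <= rho%:E)%E ->
  exists2 wh, W wh & `|j w - wh| <= (rho + delta) * `|w|.
Proof.
move=> T0 W0 d0 hr.
have [->|w0] := eqVneq w 0.
  by exists 0 => //; rewrite linear0 subr0 !normr0 mulr0.
have nw : 0 < `|w| by rewrite normr_gt0.
have ncst : bochner_norm +oo `[0%R, T] (fun=> w) = `|w|%:E.
  exact: bochner_normy_cst.
have : (ereal_inf [set (bochner_norm +oo `[0%R, T] (fun t => (j w - wh t)%R)
             / bochner_norm +oo `[0%R, T] (fun=> w))%E |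
             wh in Lp_bochner +oo%E `[0%R, T] W] <= rho%:E)%E.
  apply: le_trans hr; rewrite /approx_rate le_max; apply/orP; right.
  apply: ereal_sup_ubound; exists (fun=> w) => //; split.
    exact: cst_Lp_bochnery.
  rewrite ncst => -[] /eqP; apply/negP; by rewrite gt_eqF.
have rd : (rho%:E < (rho + delta)%:E)%E by rewrite lte_fin ltrDl.
move=> /le_lt_trans /(_ rd) /ereal_inf_lt[_ [wh [_ _ whW] <-]].
rewrite ncst inver gt_eqF// lte_pdivrMr// -EFinM => /ltW hlt.
have M0 : 0 <= (rho + delta) * `|w|.
  by rewrite -lee_fin (le_trans _ hlt)// bochner_normy_ge0.
move/bochner_normy_leP : hlt => /(_ M0) hae.
have [t tT [Wt]] := ae_exists T0 (ae_and whW hae).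
have tD : [set` `[0%R, T]] t by rewrite /= in_itv.
by move=> /(_ tD) ?; exists (wh t) => //; exact: Wt.
Qed.

End BochnerNorms.

(** * Regularity for the stationary dual problem *)

(** This makes the memory of the dual problem negligible near the final time. *)
Lemma short_Rintegral_le (R : realType) (x y c : R) (h : R -> R) :
  x <= y -> 0 <= c ->
  {ae @lebesgue_measure R, forall s, `[x, y]%classic s -> `|h s| <= c} ->
  `|\int[@lebesgue_measure R]_(s in `[x, y]) h s| <= c * (y - x).
Proof.
move=> xy c0 hc.
apply: le_trans (normr_Rintegral_le (g := cst c) _ _ hc) _ => //.
  exact: integrable_lt_pinfty (integrable_cst_itv _ _ _ _ _).
rewrite Rintegral_cst//= lebesgue_measure_itv /= lte_fin.
by case: ltP => //= _; rewrite mulr0 mulr_ge0// subr_ge0.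
Qed.

Section StaticDual.
Context (R : realType) (V Q : completeNormedModType R).
Context (a : {biscalar V}) (b : {bilinear V -> Q -> R | *%R & *%R}).
Context (k1 k2 k3 : R -> R -> R) (T C1 C2 C3 : R).
Context (Vm Qm Vpp Qpp : completeNormedModType R).
Context (iV : {linear V -> Vm}) (iQ : {linear Q -> Qm}).
Context (jV : {linear Vpp -> V}) (jQ : {linear Qpp -> Q}).
Hypothesis (hk1 : bounded_kernel T C1 k1) (hk2 : bounded_kernel T C2 k2).
Hypothesis (hk3 : bounded_kernel T C3 k3).
Hypothesis a_cont : continuous (fun z : V * V => a z.1 z.2).
Hypothesis b_cont : continuous (fun z : V * Q => b z.1 z.2).
Hypothesis (jV_cont : continuous jV) (jQ_cont : continuous jQ).
Hypothesis T0 : 0 < T.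
Hypothesis hdual : dual_regularity a b k1 k2 k3 iV iQ jV jQ T.
Local Notation mu := (@lebesgue_measure R).

(** With data constant in time, the memory integral over [[t, T]] vanishes as
    [t] tends to [T], so that the dual solution at a time close to [T] is almost
    a solution of the stationary adjoint problem. *)
Lemma static_dual_regularity : exists2 Chat, 0 <= Chat &
  forall (phi : dual Vm) (gamma : dual Qm) (delta : R),
  `|phi| <= 1 -> `|gamma| <= 1 -> 0 < delta ->
  exists (w : Vpp) (n : Qpp), [/\ `|w| + `|n| <= Chat,
    forall v, `|a v (jV w) + b v (jQ n) - phi (iV v)| <= delta * `|v| &
    forall q, `|b (jV w) q - gamma (iQ q)| <= delta * `|q|].
Proof.
have [Ca Ca0 aC] := bilinear_bounded a_cont.
have [Cb Cb0 bC] := bilinear_bounded b_cont.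
have [Cj Cj0 jC] := linear_bounded jV_cont.
have [Cl Cl0 lC] := linear_bounded jQ_cont.
have T0T : 0 <= T <= T by rewrite lexx ltW.
have [Chat hC] := hdual T0T.
pose M := `|Chat| * 2.
have M0 : 0 <= M by rewrite mulr_ge0.
exists (M + M) => [|phi gamma delta phi1 gamma1 d0]; first by rewrite addr_ge0.
have mJ : measurable [set` `[0%R, T]] by [].
have [[w [m ds]] hreg] := hC (fun=> phi) (fun=> gamma)
  (cst_Lp_bochnery phi mJ) (cst_Lp_bochnery gamma mJ).
have [wp [mp [_ _ wmE hnorm]]] := hreg _ _ ds.
have [_ _ dseq] := ds.
have normsum : (bochner_norm +oo `[0%R, T] wp + bochner_norm +oo `[0%R, T] mp <= M%:E)%E.
  apply: le_trans hnorm _; rewrite !bochner_normy_cst// -EFinD -EFinM lee_fin.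
  rewrite (le_trans (ler_norm _))// normrM ler_wpM2l//.
  by rewrite ger0_norm ?addr_ge0// lerD.
have wpM : (bochner_norm +oo `[0%R, T] wp <= M%:E)%E.
  by apply: le_trans normsum; rewrite leeDl// bochner_normy_ge0.
have mpM : (bochner_norm +oo `[0%R, T] mp <= M%:E)%E.
  by apply: le_trans normsum; rewrite leeDr// bochner_normy_ge0.
move/bochner_normy_leP : wpM => /(_ M0) wpM.
move/bochner_normy_leP : mpM => /(_ M0) mpM.
pose L := `|C1| * (Ca * (Cj * M)) + `|C2| * (Cb * (Cl * M)) + `|C3| * (Cb * (Cj * M)).
have L1_ge0 : 0 <= `|C1| * (Ca * (Cj * M)) by rewrite !mulr_ge0.
have L2_ge0 : 0 <= `|C2| * (Cb * (Cl * M)) by rewrite !mulr_ge0.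
have L3_ge0 : 0 <= `|C3| * (Cb * (Cj * M)) by rewrite !mulr_ge0.
have L0 : 0 <= L by rewrite !addr_ge0.
(* on [[x, T]] the memory terms, of density at most [L * `|v|],
   contribute at most [delta * `|v|] *)
pose x := Num.max 0 (T - delta / (L + 1)).
have L10 : 0 < L + 1 by rewrite ltr_wpDl.
have xT : x < T by rewrite /x gt_max T0 /= ltrBlDr ltrDl divr_gt0.
have aeall := ae_and (ae_and wmE dseq) (ae_and wpM mpM).
have [t /andP[xt tT] [[]]] := ae_exists xT aeall.
have t0 : 0 <= t by apply: le_trans xt; rewrite le_max lexx.
have tJ : t \in `[0, T] by rewrite in_itv /= t0.
have Ltd : L * (T - t) <= delta.
  have : T - t <= delta / (L + 1).
    by rewrite lerBlDr addrC -lerBlDr (le_trans _ xt)// le_max lexx orbT.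
  move=> /(ler_wpM2l L0) /le_trans; apply.
  by rewrite mulrA ler_pdivrMr// mulrC ler_wpM2l ?lerDl// ltW.
move=> /(_ tJ)[wtE mtE] /(_ tJ) eqt [/(_ tJ) wpt /(_ tJ) mpt].
exists (wp t), (mp t); split; first exact: lerD.
- move=> v.
  have [eqv _] := eqt v 0; move: eqv; rewrite wtE mtE => ->.
  rewrite addrC addKr.
  have hbound : {ae mu, forall s, `[t, T]%classic s ->
      `|k1 s t * a v (w s) + k2 s t * b v (m s)| <= L * `|v|}.
    apply: ae_imp aeall => s [[wmEs _] [wps mps]] /=.
    rewrite in_itv /= => /andP[ts sT].
    have sJ : s \in `[0, T] by rewrite in_itv /= (le_trans t0).
    have [-> ->] := wmEs sJ.
    rewrite (le_trans (ler_normD _ _))// /L !mulrDl.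
    apply: (@le_trans _ _ (`|C1| * (Ca * (Cj * M)) * `|v| +
        `|C2| * (Cb * (Cl * M)) * `|v|)); last first.
      by rewrite lerDl mulr_ge0.
    rewrite !normrM; apply: lerD; rewrite -mulrA ler_pM//.
    + by rewrite (le_trans (hk1.2 _ _ _ _ _))// ler_norm.
    + rewrite (le_trans (aC _ _))// mulrAC ler_wpM2r// ler_wpM2l//.
      by rewrite (le_trans (jC _))// ler_wpM2l// wps.
    + by rewrite (le_trans (hk2.2 _ _ _ _ _))// ler_norm.
    + rewrite (le_trans (bC _ _))// mulrAC ler_wpM2r// ler_wpM2l//.
      by rewrite (le_trans (lC _))// ler_wpM2l// mps.
  apply: le_trans (short_Rintegral_le tT _ hbound) _; first by rewrite mulr_ge0.
  by rewrite mulrAC ler_wpM2r.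
- move=> q.
  have [_ eqq] := eqt 0 q; move: eqq; rewrite wtE => ->.
  rewrite addrC addKr.
  have hbound : {ae mu, forall s, `[t, T]%classic s ->
      `|k3 s t * b (w s) q| <= L * `|q|}.
    apply: ae_imp aeall => s [[wmEs _] [wps mps]] /=.
    rewrite in_itv /= => /andP[ts sT].
    have sJ : s \in `[0, T] by rewrite in_itv /= (le_trans t0).
    have [-> _] := wmEs sJ.
    apply: (@le_trans _ _ (`|C3| * (Cb * (Cj * M)) * `|q|)); last first.
      by rewrite ler_wpM2r// /L lerDr addr_ge0.
    rewrite normrM -mulrA ler_pM//.
    + by rewrite (le_trans (hk3.2 _ _ _ _ _))// ler_norm.
    + rewrite (le_trans (bC _ _))// ler_wpM2r// ler_wpM2l//.
      by rewrite (le_trans (jC _))// ler_wpM2l// wps.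
  apply: le_trans (short_Rintegral_le tT _ hbound) _; first by rewrite mulr_ge0.
  by rewrite mulrAC ler_wpM2r.
Qed.

End StaticDual.

(** * Representatives and the equations of the Galerkin error *)

Section Representatives.
Context (R : realType).
Local Notation mu := (@lebesgue_measure R).

Lemma simple_limit_functional (X : normedModType R) (D : set (measurableTypeR R))
    (l : X -> R) (f : R -> X) : measurable D -> continuous l ->
  simple_limit D f -> measurable_fun D (fun t : measurableTypeR R => l (f t)).
Proof.
move=> mD cl sf; apply: simple_limit_measurable => //.
exact: (@simple_limit_comp R X R^o).
Qed.

Lemma Lp_bochner1_representative (X : normedModType R) (D : set (measurableTypeR R))
    (W : set X) (f : R -> X) : measurable D -> Lp_bochner 1%:E D W f ->
  exists f', [/\ simple_limit D f', {ae mu, forall t, D t -> f' t = f t} &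
    mu.-integrable D (fun t : measurableTypeR R => `|f' t|%:E)].
Proof.
move=> mD [sf nf _].
have [f' [sf' ff']] := strongly_measurable_simple_limit mD sf.
exists f'; split => //; apply/integrableP; split.
  apply/measurable_EFinP; apply: simple_limit_functional => //.
  exact: norm_continuous.
under eq_integral do rewrite gee0_abs//.
by rewrite -(integral_bochner_norm1 ff').
Qed.

Lemma integrable_normB (X : normedModType R) (D : set (measurableTypeR R))
    (f g : R -> X) : measurable D -> simple_limit D f -> simple_limit D g ->
  mu.-integrable D (fun t : measurableTypeR R => `|f t|%:E) ->
  mu.-integrable D (fun t : measurableTypeR R => `|g t|%:E) ->
  mu.-integrable D (fun t : measurableTypeR R => `|f t - g t|%:E).
Proof.
move=> mD sf sg jf jg.
apply: (@le_integrable _ _ _ mu _ _ _ ((fun t : measurableTypeR R => `|f t|%:E) \+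
   (fun t : measurableTypeR R => `|g t|%:E))%E) => //.
- apply/measurable_EFinP.
  apply: (simple_limit_functional (l := fun x : X => `|x|)) (simple_limitB sf sg) => //.
  exact: norm_continuous.
- move=> t _; rewrite -EFinD lee_fin normr_id ger0_norm ?addr_ge0//.
  exact: ler_normB.
- exact: integrableD.
Qed.

Lemma bochner_norm1D (X Y : normedModType R) (D : set (measurableTypeR R))
    (f f' : R -> X) (g g' : R -> Y) : measurable D ->
  {ae mu, forall t, D t -> f' t = f t} -> {ae mu, forall t, D t -> g' t = g t} ->
  mu.-integrable D (fun t : measurableTypeR R => `|f' t|%:E) ->
  mu.-integrable D (fun t : measurableTypeR R => `|g' t|%:E) ->
  (bochner_norm 1%:E D f + bochner_norm 1%:E D g)%E =
    (\int[mu]_(t in D) (`|f' t| + `|g' t|))%:E.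
Proof.
move=> mD ff gg jf jg.
rewrite (integral_bochner_norm1 ff) (integral_bochner_norm1 gg).
rewrite -ge0_integralD//; last 2 first.
  exact: measurable_int jf.
  exact: measurable_int jg.
by rewrite /Rintegral fineK//; exact: integrable_fin_num (integrableD mD jf jg).
Qed.

Lemma kernel_slice_measurable (T C t : R) (k : R -> R -> R) :
  bounded_kernel T C k -> t <= T ->
  measurable_fun (`[0, t]%classic : set (measurableTypeR R)) (k t).
Proof.
move=> [ck _] tT; apply: subspace_continuous_measurable_fun => //.
apply/subspace_continuousP => s; rewrite /= in_itv /= => /andP[s0 st].
move/subspace_continuousP : ck => /(_ (t, s)) /=.
rewrite s0 st tT => /(_ (conj isT isT)) h U /h /= hU.
have cts : (t, x) @[x --> s] --> (t, s).
  exact: (cvg_pair (cvg_cst t) cvg_id).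
have := cts _ hU; rewrite /= !near_simpl /within /=.
apply: filterS => x hx; rewrite in_itv /= => /andP[x0 xt]; apply: hx => /=.
by rewrite x0 xt tT.
Qed.

Lemma integrable_memory (T C c t : R) (k : R -> R -> R) (l N : measurableTypeR R -> R) :
  bounded_kernel T C k -> t <= T ->
  measurable_fun (`[0, T]%classic : set (measurableTypeR R)) l ->
  mu.-integrable `[0, T] (EFin \o N) ->
  (forall s, `|l s| <= c * N s) ->
  mu.-integrable `[0, t] (fun s : measurableTypeR R => (k t s * l s)%:E).
Proof.
move=> hk tT ml iN lN.
have sub : `[0, t] `<=` `[0, T]%classic by apply: subset_itvl; rewrite bnd_simp.
have iN' : mu.-integrable `[0, t] (EFin \o N) by exact: integrableS iN.
have mlt : measurable_fun (`[0, t]%classic : set (measurableTypeR R)) l.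
  exact: measurable_funS ml.
apply: (@le_integrable _ _ _ mu _ _ _ (EFin \o (fun s => C * c * N s))) => //.
- apply/measurable_EFinP; apply: measurable_funM => //.
  exact: kernel_slice_measurable hk tT.
- move=> s; rewrite /= in_itv /= => /andP[s0 st]; rewrite lee_fin normrM.
  have kC := hk.2 t s s0 st tT.
  rewrite -mulrA normrM; apply: ler_pM => //.
    by rewrite (le_trans kC)// ler_norm.
  by rewrite (le_trans (lN s))// ler_norm.
- apply: (eq_integrable _ (fun s : measurableTypeR R => (C * c)%:E * (EFin \o N) s)%E) => //.
  exact: integrableZl.
Qed.

End Representatives.

Section GalerkinError.
Context (R : realType) (V Q : completeNormedModType R).
Context (a : {biscalar V}) (b : {bilinear V -> Q -> R | *%R & *%R}).
Context (k1 k2 k3 : R -> R -> R) (T C1 C2 C3 : R).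
Hypothesis (hk1 : bounded_kernel T C1 k1) (hk2 : bounded_kernel T C2 k2).
Hypothesis (hk3 : bounded_kernel T C3 k3).
Hypothesis a_cont : continuous (fun z : V * V => a z.1 z.2).
Hypothesis b_cont : continuous (fun z : V * Q => b z.1 z.2).
Local Notation mu := (@lebesgue_measure R).
Local Notation J := (`[0, T]%classic : set (measurableTypeR R)).

Definition memory_test (e : R -> V) (eps : R -> Q) (t : R) (v : V) (s : R) : R :=
  k1 t s * a (e s) v + k2 t s * b v (eps s).

Definition error_equation (Vh : set V) (e : R -> V) (eps : R -> Q) (t : R) : Prop :=
  forall v, Vh v -> a (e t) v + b v (eps t) =
    \int[mu]_(s in `[0, t]) memory_test e eps t v s.

Lemma form_continuousl (X Y : normedModType R) (c : X -> Y -> R) (y : Y) :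
  continuous (fun z : X * Y => c z.1 z.2) -> continuous (c ^~ y).
Proof.
move=> cc x; apply: (@continuous_comp _ _ _ (fun x => (x, y)) (fun z => c z.1 z.2)).
  exact: (cvg_pair cvg_id (cvg_cst y)).
exact: (cc (x, y)).
Qed.

Lemma form_continuousr (X Y : normedModType R) (c : X -> Y -> R) (x : X) :
  continuous (fun z : X * Y => c z.1 z.2) -> continuous (c x).
Proof.
move=> cc y; apply: (@continuous_comp _ _ _ (fun y => (x, y)) (fun z => c z.1 z.2)).
  exact: (cvg_pair (cvg_cst x) cvg_id).
exact: (cc (x, y)).
Qed.

Lemma integrable_memory_test (e : R -> V) (eps : R -> Q) t v :
  simple_limit J e -> simple_limit J eps ->
  mu.-integrable J (fun s : measurableTypeR R => `|e s|%:E) ->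
  mu.-integrable J (fun s : measurableTypeR R => `|eps s|%:E) -> t <= T ->
  mu.-integrable `[0, t] (fun s : measurableTypeR R => (memory_test e eps t v s)%:E).
Proof.
move=> se seps ie ieps tT.
have [Ca Ca0 aC] := bilinear_bounded a_cont.
have [Cb Cb0 bC] := bilinear_bounded b_cont.
apply: (eq_integrable _ ((fun s : measurableTypeR R => (k1 t s * a (e s) v)%:E) \+
   (fun s : measurableTypeR R => (k2 t s * b v (eps s))%:E))%E) => //.
apply: integrableD => //.
- apply: (integrable_memory (c := Ca * `|v|) (N := fun s => `|e s|) hk1) => //.
    by apply: (simple_limit_functional (l := a ^~ v)) => //; exact: form_continuousl.
  by move=> s; rewrite mulrAC.
- apply: (integrable_memory (c := Cb * `|v|) (N := fun s => `|eps s|) hk2) => //.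
  by apply: (simple_limit_functional (l := b v)) => //; exact: form_continuousr.
Qed.

(** The errors are taken between representatives whose composites with continuous
    functions are Borel measurable, since splitting an integral of a difference
    needs measurable integrands. *)
Lemma galerkin_error (Vh : set V) (Qh : set Q) f g u p uh ph :
  Vh 0 -> Qh 0 ->
  primal_solution a b k1 k2 k3 T setT setT f g u p ->
  primal_solution a b k1 k2 k3 T Vh Qh f g uh ph ->
  exists (e : R -> V) (eps : R -> Q), [/\ simple_limit J e, simple_limit J eps,
    mu.-integrable J (fun t : measurableTypeR R => `|e t|%:E),
    mu.-integrable J (fun t : measurableTypeR R => `|eps t|%:E) &
    {ae mu, forall t, J t ->
      [/\ e t = u t - uh t, eps t = p t - ph t, error_equation Vh e eps t &
       forall q, Qh q -> b (e t) q = \int[mu]_(s in `[0, t]) (k3 t s * b (e s) q)]}].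
Proof.
move=> V0 Q0 [Lu Lp eqs] [Luh Lph eqsh].
have mJ : measurable J by [].
have [u' [su uE iu]] := Lp_bochner1_representative mJ Lu.
have [p' [sp pE ip]] := Lp_bochner1_representative mJ Lp.
have [uh' [suh uhE iuh]] := Lp_bochner1_representative mJ Luh.
have [ph' [sph phE iph]] := Lp_bochner1_representative mJ Lph.
pose e t := u' t - uh' t; pose eps t := p' t - ph' t.
have se : simple_limit J e by exact: simple_limitB.
have seps : simple_limit J eps by exact: simple_limitB.
exists e, eps; split => //; [exact: integrable_normB|exact: integrable_normB|].
have aeE := ae_and (ae_and uE pE) (ae_and uhE phE).
apply: ae_imp (ae_and aeE (ae_and eqs eqsh)) => t [[[ut pt] [uht pht]] [eqt eqht]] Jt.
have tJ : t \in `[0, T] by [].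
have tT : t <= T by move: tJ; rewrite in_itv /= => /andP[].
have subJ : `[0, t] `<=` J by apply: subset_itvl; rewrite bnd_simp.
have {}eqt := eqt tJ; have {}eqht := eqht tJ.
split; rewrite /e /eps ?ut ?uht ?pt ?pht//.
- move=> v Vv; rewrite ut// uht// pt// pht// linearBl linearBr /=.
  have [eq1 _] := eqt v 0 I I; have [eqh1 _] := eqht v 0 Vv Q0.
  rewrite addrACA -opprD eq1 eqh1 opprD addrACA subrr add0r.
  rewrite (_ : \int[mu]_(s in `[0, t]) _ =
    \int[mu]_(s in `[0, t]) memory_test u' p' t v s); last first.
    by apply: Rintegral_ae_eq; apply: ae_imp aeE => s [[us ps] _] /subJ Js;
      rewrite /memory_test us// ps.
  rewrite (_ : \int[mu]_(s in `[0, t]) (k1 t s * a (uh s) v + _) =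
    \int[mu]_(s in `[0, t]) memory_test uh' ph' t v s); last first.
    by apply: Rintegral_ae_eq; apply: ae_imp aeE => s [_ [us ps]] /subJ Js;
      rewrite /memory_test us// ps.
  rewrite -RintegralB//; last 2 first.
    exact: integrable_memory_test.
    exact: integrable_memory_test.
  apply: eq_Rintegral => s _; rewrite /memory_test /=.
  by rewrite linearBl [b _ (_ - _)]linearBr /=; ring.
- move=> q Qq; rewrite ?ut// ?uht// linearBl /=.
  have [_ eq2] := eqt 0 q I I; have [_ eqh2] := eqht 0 q V0 Qq.
  rewrite eq2 eqh2 opprD addrACA subrr add0r.
  rewrite (_ : \int[mu]_(s in `[0, t]) _ =
    \int[mu]_(s in `[0, t]) (k3 t s * b (u' s) q)); last first.
    by apply: Rintegral_ae_eq; apply: ae_imp aeE => s [[us _] _] /subJ Js; rewrite us.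
  rewrite (_ : \int[mu]_(s in `[0, t]) (k3 t s * b (uh s) q) =
    \int[mu]_(s in `[0, t]) (k3 t s * b (uh' s) q)); last first.
    by apply: Rintegral_ae_eq; apply: ae_imp aeE => s [_ [us _]] /subJ Js; rewrite us.
  have [Cb Cb0 bC] := bilinear_bounded b_cont.
  have i3 (x : R -> V) : simple_limit J x ->
      mu.-integrable J (fun s : measurableTypeR R => `|x s|%:E) ->
      mu.-integrable `[0, t] (fun s : measurableTypeR R => (k3 t s * b (x s) q)%:E).
    move=> sx ix.
    apply: (integrable_memory (c := Cb * `|q|) (N := fun s => `|x s|) hk3) => //.
      by apply: (simple_limit_functional (l := b ^~ q)) => //; exact: form_continuousl.
    by move=> s; rewrite mulrAC.
  rewrite -RintegralB//; [|exact: i3|exact: i3].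
  by apply: eq_Rintegral => s _; rewrite linearBl /= mulrBr.
Qed.

End GalerkinError.

(** * Quasi-optimality in the energy norms *)

Section ErrorEstimates.
Context (R : realType) (V Q : completeNormedModType R).
Context (a : {biscalar V}) (b : {bilinear V -> Q -> R | *%R & *%R}).
Context (k1 k2 k3 : R -> R -> R) (T C1 C2 C3 : R).
Hypothesis (hk1 : bounded_kernel T C1 k1) (hk2 : bounded_kernel T C2 k2).
Hypothesis (hk3 : bounded_kernel T C3 k3).
Hypothesis a_cont : continuous (fun z : V * V => a z.1 z.2).
Hypothesis b_cont : continuous (fun z : V * Q => b z.1 z.2).
Hypothesis T0 : 0 <= T.
Local Notation mu := (@lebesgue_measure R).
Local Notation J := (`[0, T]%classic : set (measurableTypeR R)).
Local Notation norm_fun f := (fun t : measurableTypeR R => `|f t|).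

Let subJ t : t <= T -> `[0, t] `<=` J.
Proof. by move=> tT; apply: subset_itvl; rewrite bnd_simp. Qed.

(** For each [q] the function [`|b (e t) q|] satisfies Gronwall's inequality without
    source, so its integral is zero; inserting this in the equation gives zero at
    every time at which the equation holds, so that one null set serves all [q]. *)
Lemma constraint_error0 (Qh : set Q) (e : R -> V) :
  simple_limit J e -> mu.-integrable J (EFin \o norm_fun e) ->
  {ae mu, forall t, J t -> forall q, Qh q ->
     b (e t) q = \int[mu]_(s in `[0, t]) (k3 t s * b (e s) q)} ->
  {ae mu, forall t, J t -> forall q, Qh q -> b (e t) q = 0}.
Proof.
move=> se ie eqe; have [Cb Cb0 bC] := bilinear_bounded b_cont.
have [K K0 hK] := gronwall T0 (normr_ge0 C3).
apply: ae_imp (eqe) => t eqt Jt q Qq.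
pose y : measurableTypeR R -> R := fun s => `|b (e s) q|.
have iy : mu.-integrable J (EFin \o y).
  apply: (@le_integrable _ _ _ mu _ _ _ (EFin \o (fun s => Cb * `|q| * norm_fun e s))) => //.
  - apply/measurable_EFinP.
    apply: (simple_limit_functional (l := fun v : V => `|b v q|)) => //.
    move=> v; apply: (@continuous_comp _ _ _ (b ^~ q) (fun x : R => `|x|)).
      exact: form_continuousl.
    exact: (@norm_continuous _ R).
  - move=> s _; rewrite lee_fin normr_id ger0_norm ?mulr_ge0//.
    by rewrite mulrAC.
  - apply: (eq_integrable _ (fun s => (Cb * `|q|)%:E * (EFin \o norm_fun e) s)%E) => //.
    exact: integrableZl.
have bound s : J s -> (forall q, Qh q ->
      b (e s) q = \int[mu]_(x in `[0, s]) (k3 s x * b (e x) q)) ->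
    y s <= `|C3| * \int[mu]_(x in `[0, s]) y x.
  rewrite /= in_itv /= => /andP[s0 sT] /(_ q Qq); rewrite /y => ->.
  have iys : mu.-integrable `[0, s] (EFin \o y).
    by apply: integrableS iy => //; exact: subJ.
  rewrite -RintegralZl//; apply: normr_Rintegral_le.
  - apply: integrable_lt_pinfty => //.
    apply: (eq_integrable _ (fun x => `|C3|%:E * (EFin \o y) x)%E) => //.
    exact: integrableZl.
  - by move=> x _; rewrite mulr_ge0.
  - apply: aeW => x; rewrite /= in_itv /= => /andP[x0 xs].
    rewrite normrM ler_wpM2r// (le_trans (hk3.2 _ _ _ _ _))//.
    exact: ler_norm.
have y0 : \int[mu]_(s in J) y s <= 0.
  have := hK y (cst 0); rewrite Rintegral_cst// mul0r mulr0; apply => //.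
  - exact: integrable_cst_itv.
  - by move=> s _; exact: normr_ge0.
  - by apply: ae_imp eqe => s eqs Js; rewrite /= add0r; apply: bound => //; exact: eqs.
apply/eqP; rewrite -normr_le0.
apply: le_trans (bound t Jt (eqt Jt)) _; rewrite mulr_ge0_le0//.
apply: le_trans y0; apply: ge0_Rintegral_subset => //; last first.
  by move=> s _; exact: normr_ge0.
by apply: subJ; move: Jt; rewrite /= in_itv /= => /andP[].
Qed.

(** [discrete_stability] at each time, for the discrete pair [(eta - e, zeta - eps)]:
    in its first equation the memory of the error appears as a source, its second
    one has none by [constraint_error0]. Gronwall's lemma absorbs the memory. *)
Lemma quasi_optimality (alpha beta : R) : 0 < alpha -> 0 < beta -> is_hilbert V ->
  exists2 K, 0 <= K & forall (Vh : set V) (Qh : set Q),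
  fin_dim_subspace Vh -> fin_dim_subspace Qh ->
  (forall v, b_kernel b Vh Qh v -> alpha * `|v| ^+ 2 <= a v v) ->
  (beta%:E <= inf_sup b Vh Qh)%E ->
  forall (e eta : R -> V) (eps zeta : R -> Q),
  mu.-integrable J (EFin \o norm_fun e) -> mu.-integrable J (EFin \o norm_fun eps) ->
  mu.-integrable J (EFin \o norm_fun eta) -> mu.-integrable J (EFin \o norm_fun zeta) ->
  {ae mu, forall t, J t -> [/\ error_equation a b k1 k2 Vh e eps t,
     forall q, Qh q -> b (e t) q = 0, Vh (eta t - e t) & Qh (zeta t - eps t)]} ->
  \int[mu]_(t in J) (`|e t| + `|eps t|) <= K * \int[mu]_(t in J) (`|eta t| + `|zeta t|).
Proof.
move=> al0 be0 hV.
have [Ca Ca0 aC] := bilinear_bounded a_cont.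
have [Cb Cb0 bC] := bilinear_bounded b_cont.
have [K K0 hK] := discrete_stability b Ca0 al0 be0 hV aC.
pose kappa := `|C1| * Ca + `|C2| * Cb.
have kappa0 : 0 <= kappa by rewrite addr_ge0 ?mulr_ge0.
pose c := 1 + K * (Ca + Cb + Cb).
have c0 : 0 <= c by rewrite addr_ge0 ?mulr_ge0 ?addr_ge0.
have [G G0 hG] := gronwall T0 (mulr_ge0 K0 kappa0).
exists (G * c) => [|Vh Qh fV fQ acoer binfsup e eta eps zeta ie ieps ieta izeta h].
  exact: mulr_ge0.
pose E : measurableTypeR R -> R := fun t => `|e t| + `|eps t|.
pose H : measurableTypeR R -> R := fun t => `|eta t| + `|zeta t|.
have iE : mu.-integrable J (EFin \o E) by apply: eq_integrable (integrableD _ ie ieps).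
have iH : mu.-integrable J (EFin \o H).
  by apply: eq_integrable (integrableD _ ieta izeta).
have E0 t : 0 <= E t by rewrite addr_ge0.
have H0 t : 0 <= H t by rewrite addr_ge0.
rewrite -[leRHS]mulrA -RintegralZl//; apply: hG => //.
  apply: (eq_integrable _ (fun t => c%:E * (EFin \o H) t)%E) => //.
  exact: integrableZl.
  by move=> t _; rewrite mulr_ge0.
apply: ae_imp h => t + Jt => /(_ Jt)[eqt orth Vx Qy].
have /andP[t0 tT] : 0 <= t <= T by move: Jt; rewrite /= in_itv.
have iEt : mu.-integrable `[0, t] (EFin \o E).
  by apply: integrableS iE => //; exact: subJ.
have memb v : `|\int[mu]_(s in `[0, t]) memory_test a b k1 k2 e eps t v s| <=
    kappa * \int[mu]_(s in `[0, t]) E s * `|v|.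
  rewrite mulrAC -RintegralZl//; apply: normr_Rintegral_le.
  - apply: integrable_lt_pinfty => //.
    apply: (eq_integrable _ (fun x => (kappa * `|v|)%:E * (EFin \o E) x)%E) => //.
    exact: integrableZl.
  - by move=> s _; rewrite mulr_ge0 ?mulr_ge0.
  - apply: aeW => s; rewrite /= in_itv /= => /andP[s0 st].
    rewrite (le_trans (ler_normD _ _))// !normrM.
    have k1C : `|k1 t s| <= `|C1| by rewrite (le_trans (hk1.2 _ _ _ _ _))// ler_norm.
    have k2C : `|k2 t s| <= `|C2| by rewrite (le_trans (hk2.2 _ _ _ _ _))// ler_norm.
    have h1 := ler_pM (normr_ge0 _) (normr_ge0 _) k1C (aC (e s) v).
    have h2 := ler_pM (normr_ge0 _) (normr_ge0 _) k2C (bC v (eps s)).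
    apply: le_trans (lerD h1 h2) _; rewrite -subr_ge0.
    have -> : kappa * `|v| * E s - (`|C1| * (Ca * `|e s| * `|v|) +
        `|C2| * (Cb * `|v| * `|eps s|)) =
      `|C1| * Ca * `|v| * `|eps s| + `|C2| * Cb * `|v| * `|e s|.
      by rewrite /kappa /E; ring.
    by rewrite addr_ge0 ?mulr_ge0.
have IE0 : 0 <= \int[mu]_(s in `[0, t]) E s by exact: Rintegral_ge0.
have F0 : 0 <= Ca * `|eta t| + Cb * `|zeta t| + kappa * \int[mu]_(s in `[0, t]) E s.
  by rewrite !addr_ge0 ?mulr_ge0.
have G0' : 0 <= Cb * `|eta t| by rewrite mulr_ge0.
have stab : `|eta t - e t| + `|zeta t - eps t| <= K * (Ca * `|eta t| +
    Cb * `|zeta t| + kappa * \int[mu]_(s in `[0, t]) E s + Cb * `|eta t|).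
  apply: (hK _ _ fV fQ acoer binfsup) => // [v Vv|q Qq].
    rewrite linearBl [b _ (_ - _)]linearBr /=.
    have -> : a (eta t) v - a (e t) v + (b v (zeta t) - b v (eps t)) =
        (a (eta t) v + b v (zeta t)) - (a (e t) v + b v (eps t)) by ring.
    rewrite eqt// (le_trans (ler_normB _ _))// mulrDl lerD//.
    rewrite (le_trans (ler_normD _ _))// mulrDl lerD//.
    by rewrite mulrAC.
  by rewrite linearBl /= orth// subr0.
have tri1 : `|e t| <= `|eta t| + `|eta t - e t|.
  by rewrite -{1}[e t](subKr (eta t)) ler_normB.
have tri2 : `|eps t| <= `|zeta t| + `|zeta t - eps t|.
  by rewrite -{1}[eps t](subKr (zeta t)) ler_normB.
apply: (@le_trans _ _ (H t + (`|eta t - e t| + `|zeta t - eps t|))).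
  by rewrite /E /H addrACA lerD.
apply: le_trans (lerD (lexx _) stab) _; rewrite -subr_ge0.
set I := Rintegral _ _ _.
have -> : c * H t + K * kappa * I - (H t + K * (Ca * `|eta t| + Cb * `|zeta t| +
   kappa * I + Cb * `|eta t|)) =
   K * (Cb * `|eta t| + Ca * `|zeta t| + Cb * `|zeta t|).
  by rewrite /c /H; ring.
by rewrite mulr_ge0// !addr_ge0 ?mulr_ge0.
Qed.

End ErrorEstimates.

(** * The duality argument at each time *)

Section AubinNitsche.
Context (R : realType) (V Q : completeNormedModType R).
Context (a : {biscalar V}) (b : {bilinear V -> Q -> R | *%R & *%R}).
Context (k1 k2 k3 : R -> R -> R) (T C1 C2 C3 : R).
Context (Vm Qm Vpp Qpp : completeNormedModType R).
Context (iV : {linear V -> Vm}) (iQ : {linear Q -> Qm}).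
Context (jV : {linear Vpp -> V}) (jQ : {linear Qpp -> Q}).
Hypothesis (hk1 : bounded_kernel T C1 k1) (hk2 : bounded_kernel T C2 k2).
Hypothesis (hk3 : bounded_kernel T C3 k3).
Hypothesis a_cont : continuous (fun z : V * V => a z.1 z.2).
Hypothesis b_cont : continuous (fun z : V * Q => b z.1 z.2).
Hypothesis (jV_cont : continuous jV) (jQ_cont : continuous jQ).
Hypothesis T0 : 0 < T.
Hypothesis (hVm : is_hilbert Vm) (hQm : is_hilbert Qm).
Hypothesis hdual : dual_regularity a b k1 k2 k3 iV iQ jV jQ T.
Local Notation mu := (@lebesgue_measure R).
Local Notation J := (`[0, T]%classic : set (measurableTypeR R)).
Local Notation norm_fun f := (fun t : measurableTypeR R => `|f t|).

Let subJ t : t <= T -> `[0, t] `<=` J.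
Proof. by move=> tT; apply: subset_itvl; rewrite bnd_simp. Qed.

(** One parameter [delta] serves for the defect in the dual equations and for the
    gap to the infima in the approximation rates, so that both vanish together. *)
Lemma discrete_dual_pair : exists2 c, 0 <= c &
  forall (Vh : set V) (Qh : set Q) (rho1 rho2 : R),
  Vh 0 -> Qh 0 -> 0 <= rho1 -> 0 <= rho2 ->
  (approx_rate jV `[0%R, T] Vh <= rho1%:E)%E ->
  (approx_rate jQ `[0%R, T] Qh <= rho2%:E)%E ->
  forall (phi : dual Vm) (gamma : dual Qm) (delta : R),
  `|phi| <= 1 -> `|gamma| <= 1 -> 0 < delta ->
  exists W N wh nh, [/\ Vh wh, Qh nh,
    `|W - wh| <= c * (rho1 + rho2 + delta) /\ `|N - nh| <= c * (rho1 + rho2 + delta),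
    forall v, `|a v W + b v N - phi (iV v)| <= delta * `|v| &
    forall q, `|b W q - gamma (iQ q)| <= delta * `|q|].
Proof.
have [c c0 hc] := static_dual_regularity hk1 hk2 hk3 a_cont b_cont jV_cont jQ_cont T0 hdual.
exists c => // Vh Qh rho1 rho2 V0 Q0 r1 r2 hr1 hr2 phi gamma delta phi1 gamma1 d0.
have [w [n [wn hw hn]]] := hc phi gamma delta phi1 gamma1 d0.
have [wh Vwh hwh] := approx_rate_elementary w T0 V0 d0 hr1.
have [nh Qnh hnh] := approx_rate_elementary n T0 Q0 d0 hr2.
exists (jV w), (jQ n), wh, nh; split => //; split.
- apply: le_trans hwh _; rewrite mulrC ler_pM ?addr_ge0 ?(ltW d0)//.
    by apply: le_trans wn; rewrite lerDl.
  by rewrite lerD2r lerDl.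
- apply: le_trans hnh _; rewrite mulrC ler_pM ?addr_ge0 ?(ltW d0)//.
    by apply: le_trans wn; rewrite lerDr.
  by rewrite lerD2r lerDr.
Qed.

(** The duality argument at one time [t]: the error is tested with the almost
    stationary dual pair [(W, N)], whose discrete approximations [(wh, nh)] are
    admissible in the error equation. In the memory term the two forms carry
    different kernels, so [a (e s) wh] and [b wh (eps s)] are compared
    separately with [phi] and [gamma]; for the former this needs
    [b (e s) nh = 0]. *)
Lemma duality_at_time (Ca Cb theta eta delta t : R) (Vh : set V) (Qh : set Q)
    (e : R -> V) (eps : R -> Q) (phi : dual Vm) (gamma : dual Qm) W N wh nh :
  0 <= Ca -> 0 <= Cb ->
  (forall v w, `|a v w| <= Ca * `|v| * `|w|) ->
  (forall v q, `|b v q| <= Cb * `|v| * `|q|) ->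
  theta = delta + (Ca + Cb) * eta ->
  0 <= eta -> 0 <= delta -> J t -> Vh wh -> Qh nh ->
  `|W - wh| <= eta -> `|N - nh| <= eta ->
  (forall v, `|a v W + b v N - phi (iV v)| <= delta * `|v|) ->
  (forall q, `|b W q - gamma (iQ q)| <= delta * `|q|) ->
  `|phi| <= 1 -> `|gamma| <= 1 ->
  phi (iV (e t)) = `|iV (e t)| -> gamma (iQ (eps t)) = `|iQ (eps t)| ->
  mu.-integrable J (EFin \o norm_fun e) -> mu.-integrable J (EFin \o norm_fun eps) ->
  mu.-integrable J (fun s : measurableTypeR R => (`|iV (e s)| + `|iQ (eps s)|)%:E) ->
  error_equation a b k1 k2 Vh e eps t ->
  (forall q, Qh q -> b (e t) q = 0) ->
  {ae mu, forall s, J s -> forall q, Qh q -> b (e s) q = 0} ->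
  `|iV (e t)| + `|iQ (eps t)| <=
    theta * (`|e t| + `|eps t| +
      (`|C1| + `|C2|) * \int[mu]_(s in J) (`|e s| + `|eps s|)) +
    (`|C1| + `|C2|) * \int[mu]_(s in `[0, t]) (`|iV (e s)| + `|iQ (eps s)|).
Proof.
move=> Ca0 Cb0 aC bC thE eta0 d0 Jt Vwh Qnh Wwh Nnh hW hN phi1 gamma1 phit gammat.
move=> ie ieps iy eqt ortht orth.
have /andP[t0 tT] : 0 <= t <= T by move: Jt; rewrite /= in_itv.
have Cae0 : 0 <= Ca * eta by exact: mulr_ge0.
have Cbe0 : 0 <= Cb * eta by exact: mulr_ge0.
have th0 : 0 <= theta by rewrite thE addr_ge0// mulr_ge0// addr_ge0.
have aWwh v : `|a v (W - wh)| <= Ca * eta * `|v|.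
  by rewrite (le_trans (aC _ _))// mulrAC ler_wpM2r// ler_wpM2l.
have bWwh q : `|b (W - wh) q| <= Cb * eta * `|q|.
  by rewrite (le_trans (bC _ _))// ler_wpM2r// ler_wpM2l.
have bNnh v : (forall q, Qh q -> b v q = 0) -> `|b v N| <= Cb * eta * `|v|.
  move=> v0; have -> : b v N = b v (N - nh) by rewrite linearBr (v0 _ Qnh) subr0.
  by rewrite (le_trans (bC _ _))// mulrAC ler_wpM2r// ler_wpM2l.
have cmpa v : (forall q, Qh q -> b v q = 0) ->
    `|a v wh - phi (iV v)| <= theta * `|v|.
  move=> v0; have := hW v; have := bNnh v v0; have := aWwh v.
  rewrite linearBr /= thE => h1 h2 h3.
  have -> : a v wh - phi (iV v) =
    (a v W + b v N - phi (iV v)) - b v N - (a v W - a v wh) by ring.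
  rewrite (le_trans (ler_normB _ _))// (le_trans (lerD (ler_normB _ _) (lexx _)))//.
  rewrite (le_trans (lerD (lerD h3 h2) h1))// -subr_ge0.
  by rewrite (_ : _ - _ = 0)//; ring.
have cmpb q : `|b wh q - gamma (iQ q)| <= theta * `|q|.
  have := hN q; have := bWwh q; rewrite linearBl /= thE => h1 h2.
  have -> : b wh q - gamma (iQ q) =
    (b W q - gamma (iQ q)) - (b W q - b wh q) by ring.
  rewrite (le_trans (ler_normB _ _))// (le_trans (lerD h2 h1))// -subr_ge0.
  rewrite (_ : _ - _ = Ca * eta * `|q|) ?mulr_ge0//; ring.
have phile x : `|phi x| <= `|x|.
  by rewrite (le_trans (dual_le_norm _ _))// ler_piMl.
have gammale x : `|gamma x| <= `|x|.
  by rewrite (le_trans (dual_le_norm _ _))// ler_piMl.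
have at_t : `|iV (e t)| + `|iQ (eps t)| <= a (e t) wh + b wh (eps t) +
    theta * (`|e t| + `|eps t|).
  have := cmpa (e t) ortht; have := cmpb (eps t); rewrite phit gammat.
  by rewrite !ler_norml => /andP[h1 _] /andP[h2 _]; rewrite mulrDr; lra.
pose kappa := `|C1| + `|C2|.
have kappa0 : 0 <= kappa by rewrite addr_ge0.
pose E : measurableTypeR R -> R := fun s => `|e s| + `|eps s|.
pose y : measurableTypeR R -> R := fun s => `|iV (e s)| + `|iQ (eps s)|.
have E0 s : 0 <= E s by rewrite addr_ge0.
have y0 s : 0 <= y s by rewrite addr_ge0.
have iE : mu.-integrable J (EFin \o E) by apply: eq_integrable (integrableD _ ie ieps).
have sub := subJ tT.
have iEt : mu.-integrable `[0, t] (EFin \o E) by exact: integrableS iE.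
have iyt : mu.-integrable `[0, t] (EFin \o y) by exact: integrableS iy.
pose z : measurableTypeR R -> R := fun s => y s + theta * E s.
have iyE : mu.-integrable `[0, t] (EFin \o z).
  apply: (eq_integrable _ ((EFin \o y) \+ (fun s => theta%:E * (EFin \o E) s))%E) => //.
  by apply: integrableD => //; exact: integrableZl.
have mem : `|\int[mu]_(s in `[0, t]) memory_test a b k1 k2 e eps t wh s| <=
    \int[mu]_(s in `[0, t]) (kappa * (y s + theta * E s)).
  apply: normr_Rintegral_le.
  - apply: integrable_lt_pinfty => //.
    apply: (eq_integrable _ (fun s => kappa%:E * (EFin \o z) s)%E) => //.
    exact: integrableZl.
  - by move=> s _; rewrite mulr_ge0// addr_ge0// mulr_ge0.
  apply: ae_imp orth => s orths st; have {}orths := orths (sub _ st).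
  move: st; rewrite /= in_itv /= => /andP[s0 st].
  have k1C : `|k1 t s| <= `|C1| by rewrite (le_trans (hk1.2 _ _ _ _ _))// ler_norm.
  have k2C : `|k2 t s| <= `|C2| by rewrite (le_trans (hk2.2 _ _ _ _ _))// ler_norm.
  have ha : `|a (e s) wh| <= y s + theta * E s.
    rewrite -[a (e s) wh](subrK (phi (iV (e s)))) (le_trans (ler_normD _ _))//.
    rewrite addrC; apply: lerD; first by rewrite (le_trans (phile _))// lerDl.
    by rewrite (le_trans (cmpa _ orths))// ler_wpM2l// lerDl.
  have hb : `|b wh (eps s)| <= y s + theta * E s.
    rewrite -[b wh (eps s)](subrK (gamma (iQ (eps s)))) (le_trans (ler_normD _ _))//.
    rewrite addrC; apply: lerD; first by rewrite (le_trans (gammale _))// lerDr.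
    by rewrite (le_trans (cmpb _))// ler_wpM2l// lerDr.
  rewrite (le_trans (ler_normD _ _))// !normrM /kappa mulrDl.
  by apply: lerD; apply: ler_pM.
have memE : \int[mu]_(s in `[0, t]) (kappa * (y s + theta * E s)) =
    kappa * (\int[mu]_(s in `[0, t]) y s + theta * \int[mu]_(s in `[0, t]) E s).
  rewrite RintegralZl// RintegralD// ?RintegralZl//.
  apply: (eq_integrable _ (fun s => theta%:E * (EFin \o E) s)%E) => //.
  exact: integrableZl.
have IE : \int[mu]_(s in `[0, t]) E s <= \int[mu]_(s in J) E s.
  exact: ge0_Rintegral_subset.
apply: le_trans at_t _; rewrite eqt//.
apply: le_trans (lerD (le_trans (ler_norm _) mem) (lexx _)) _; rewrite memE.
rewrite -/kappa -/(E t) -/(E _) -subr_ge0.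
move: IE; rewrite -subr_ge0 => /(mulr_ge0 (mulr_ge0 kappa0 th0)).
set I1 := Rintegral _ _ E; set I2 := Rintegral _ _ E; set I3 := Rintegral _ _ y.
move=> h; apply: le_trans h _; rewrite le_eqVlt; apply/orP; left; apply/eqP.
by rewrite /E; ring.
Qed.

(** The defect [delta] of [duality_at_time] tends to zero before Gronwall's lemma is
    applied. *)
Lemma duality_estimate : exists2 K, 0 <= K &
  forall (Vh : set V) (Qh : set Q) (rho1 rho2 : R),
  Vh 0 -> Qh 0 -> 0 <= rho1 -> 0 <= rho2 ->
  (approx_rate jV `[0%R, T] Vh <= rho1%:E)%E ->
  (approx_rate jQ `[0%R, T] Qh <= rho2%:E)%E ->
  forall (e : R -> V) (eps : R -> Q),
  mu.-integrable J (EFin \o norm_fun e) -> mu.-integrable J (EFin \o norm_fun eps) ->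
  mu.-integrable J (fun s : measurableTypeR R => (`|iV (e s)| + `|iQ (eps s)|)%:E) ->
  {ae mu, forall t, J t -> error_equation a b k1 k2 Vh e eps t /\
     forall q, Qh q -> b (e t) q = 0} ->
  \int[mu]_(t in J) (`|iV (e t)| + `|iQ (eps t)|) <=
    K * (rho1 + rho2) * \int[mu]_(t in J) (`|e t| + `|eps t|).
Proof.
have [Ca Ca0 aC] := bilinear_bounded a_cont.
have [Cb Cb0 bC] := bilinear_bounded b_cont.
have [c c0 hc] := discrete_dual_pair.
pose kappa := `|C1| + `|C2|.
have kappa0 : 0 <= kappa by rewrite addr_ge0.
have [G G0 hG] := gronwall (ltW T0) kappa0.
exists (G * ((Ca + Cb) * c * (1 + kappa * T))).
  by rewrite !mulr_ge0 ?addr_ge0 ?mulr_ge0// ltW.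
move=> Vh Qh rho1 rho2 V0 Q0 r1 r2 hr1 hr2 e eps ie ieps iy h.
pose E : measurableTypeR R -> R := fun s => `|e s| + `|eps s|.
pose y : measurableTypeR R -> R := fun s => `|iV (e s)| + `|iQ (eps s)|.
have E0 s : 0 <= E s by rewrite addr_ge0.
have iE : mu.-integrable J (EFin \o E) by apply: eq_integrable (integrableD _ ie ieps).
set IE := \int[mu]_(s in J) E s.
have IE0 : 0 <= IE by exact: Rintegral_ge0.
pose theta0 := (Ca + Cb) * (c * (rho1 + rho2)).
have th00 : 0 <= theta0 by rewrite !mulr_ge0// addr_ge0.
pose alpha : measurableTypeR R -> R := fun t => theta0 * (E t + kappa * IE).
pose z : measurableTypeR R -> R := fun s => E s + kappa * IE.
have iEc : mu.-integrable J (EFin \o z).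
  apply: (eq_integrable _ ((EFin \o E) \+ (EFin \o cst (kappa * IE)%R))%E) => //.
  by apply: integrableD => //; exact: integrable_cst_itv.
have ialpha : mu.-integrable J (EFin \o alpha).
  apply: (eq_integrable _ (fun s => theta0%:E * (EFin \o z) s)%E) => //.
  exact: integrableZl.
have -> : G * ((Ca + Cb) * c * (1 + kappa * T)) * (rho1 + rho2) * IE =
    G * \int[mu]_(t in J) alpha t.
  rewrite RintegralZl// (RintegralD (f2 := cst (kappa * IE)))//; last first.
    exact: integrable_cst_itv.
  rewrite -/IE Rintegral_cst//= lebesgue_measure_itv /= lte_fin T0 /= subr0.
  by rewrite /theta0; ring.
apply: (hG y alpha) => //.
- by move=> t _; rewrite addr_ge0.
- by move=> t _; rewrite mulr_ge0// addr_ge0// mulr_ge0.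
apply: ae_imp (h) => t + Jt => /(_ Jt)[eqt orth].
have orthae : {ae mu, forall s, J s -> forall q, Qh q -> b (e s) q = 0}.
  by apply: ae_imp h => s hs Js; exact: (hs Js).2.
have [phi [phi1 phit]] := norming_functional (iV (e t)) hVm.
have [gamma [gamma1 gammat]] := norming_functional (iQ (eps t)) hQm.
set B := E t + kappa * IE.
have B0 : 0 <= B by rewrite addr_ge0// mulr_ge0.
have D0 : 0 < 1 + (Ca + Cb) * c by rewrite ltr_pwDl// mulr_ge0// addr_ge0.
(* [delta] makes the defect [delta + (Ca + Cb) * c * delta] times [B] at most [x] *)
apply/ler_addgt0Pr => x x0.
pose delta := x / ((1 + (Ca + Cb) * c) * (B + 1)).
have B1 : 0 < B + 1 by rewrite ltr_wpDl.
have delta0 : 0 < delta by rewrite divr_gt0// mulr_gt0.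
have [W [N [wh [nh [Vwh Qnh [Wwh Nnh] hW hN]]]]] :=
  hc Vh Qh rho1 rho2 V0 Q0 r1 r2 hr1 hr2 phi gamma delta phi1 gamma1 delta0.
have eta0 : 0 <= c * (rho1 + rho2 + delta) by rewrite mulr_ge0// !addr_ge0// ltW.
have := duality_at_time Ca0 Cb0 aC bC erefl eta0 (ltW delta0) Jt Vwh Qnh Wwh Nnh
  hW hN phi1 gamma1 phit gammat ie ieps iy eqt orth orthae.
rewrite -/kappa -/(y t) -/(E t) => hy; apply: le_trans hy _.
rewrite -/IE -/B [leRHS]addrAC lerD2r.
have -> : (delta + (Ca + Cb) * (c * (rho1 + rho2 + delta))) * B =
    alpha t + delta * (1 + (Ca + Cb) * c) * B.
  by rewrite /alpha -/B /theta0; ring.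
rewrite lerD2l /delta invfM mulrA mulrAC -!mulrA.
rewrite [X in x * X](_ : _ = B / (B + 1)); last by field; rewrite !gt_eqF.
by apply: ler_piMr; [exact: ltW|rewrite ler_pdivrMr// mul1r lerDl].
Qed.

End AubinNitsche.

(** * The error estimate in the weak norms *)

(** The infima over [v] and over [q] are separate, while quasi-optimality compares
    the error with a pair [(v, q)]. *)
Lemma ereal_inf_add_ge (R : realType) (A B : set (\bar R)) (c : R) :
  (forall x, A x -> (0 <= x)%E) -> (forall y, B y -> (0 <= y)%E) ->
  (forall x y, A x -> B y -> (c%:E <= x + y)%E) ->
  (c%:E <= ereal_inf A + ereal_inf B)%E.
Proof.
move=> A0 B0 cAB.
have : (0 <= ereal_inf A)%E by apply: le_ereal_inf_tmp => x /A0.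
have : (0 <= ereal_inf B)%E by apply: le_ereal_inf_tmp => x /B0.
case EA : (ereal_inf A) => [x| |] //; case EB : (ereal_inf B) => [y| |] // y0 x0;
  rewrite ?leey ?addye ?addey//.
rewrite -EFinD lee_fin leNgt; apply/negP => xyc.
pose d := (c - (x + y)) / 2.
have d0 : 0 < d by rewrite divr_gt0// subr_gt0.
have : (ereal_inf A < (x + d)%:E)%E by rewrite EA lte_fin ltrDl.
move=> /ereal_inf_lt[x' Ax' x'd].
have : (ereal_inf B < (y + d)%:E)%E by rewrite EB lte_fin ltrDl.
move=> /ereal_inf_lt[y' By' y'd].
have := le_lt_trans (cAB _ _ Ax' By') (lteD x'd y'd).
rewrite -EFinD lte_fin addrACA -mulr2n -mulr_natr divfK// addrC subrK.
by rewrite ltxx.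
Qed.

Unset Implicit Arguments.

Theorem theorem2p7 (R : realType)
  (V Q : completeNormedModType R) (hV : is_hilbert V) (hQ : is_hilbert Q)
  (T : R) (T_ge0 : 0 <= T)
  (k1 k2 k3 : R -> R -> R) (Ck1 Ck2 Ck3 : R)
  (hk1 : bounded_kernel T Ck1 k1) (hk2 : bounded_kernel T Ck2 k2)
  (hk3 : bounded_kernel T Ck3 k3)
  (a : {biscalar V}) (b : {bilinear V -> Q -> R | *%R & *%R})
  (a_sym : forall v w, a v w = a w v) (a_psd : forall v, 0 <= a v v)
  (a_cont : continuous (fun z : V * V => a z.1 z.2))
  (b_cont : continuous (fun z : V * Q => b z.1 z.2))
  (alpha0 : R) (alpha0_gt0 : 0 < alpha0)
  (a_coercive : forall v0, b_kernel b setT setT v0 ->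
     alpha0 * `|v0| ^+ 2 <= a v0 v0)
  (Vm Qm : completeNormedModType R) (hVm : is_hilbert Vm) (hQm : is_hilbert Qm)
  (iV : {linear V -> Vm}) (iQ : {linear Q -> Qm})
  (hiV : cont_embedding iV) (hiQ : cont_embedding iQ)
  (iV_dense : dense (range iV)) (iQ_dense : dense (range iQ))
  (Vpp Qpp : completeNormedModType R)
  (jV : {linear Vpp -> V}) (jQ : {linear Qpp -> Q})
  (hjV : cont_embedding jV) (hjQ : cont_embedding jQ)
  (H : set R) (Vh : R -> set V) (Qh : R -> set Q)
  (hVh : forall h, H h -> fin_dim_subspace (Vh h))
  (hQh : forall h, H h -> fin_dim_subspace (Qh h))
  (alphas betas : R) (alphas_gt0 : 0 < alphas) (betas_gt0 : 0 < betas)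
  (a_coercive_h : forall h, H h -> forall v0, b_kernel b (Vh h) (Qh h) v0 ->
     alphas * `|v0| ^+ 2 <= a v0 v0)
  (b_inf_sup_h : forall h, H h -> (betas%:E <= inf_sup b (Vh h) (Qh h))%E)
  (f : R -> dual V) (g : R -> dual Q)
  (hf : Lp_bochner 1%:E `[0, T] setT f) (hg : Lp_bochner 1%:E `[0, T] setT g)
  (u : R -> V) (p : R -> Q)
  (hup : unique_primal_solution a b k1 k2 k3 T setT setT f g u p)
  (uh : R -> R -> V) (ph : R -> R -> Q)
  (huph : forall h, H h ->
     unique_primal_solution a b k1 k2 k3 T (Vh h) (Qh h) f g (uh h) (ph h))
  (hdual : dual_regularity a b k1 k2 k3 iV iQ jV jQ T) :
  let J := [set` `[0, T]] in
  let err h := (bochner_norm 1%:E J (fun t => iV (u t - uh h t)%R) +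
                bochner_norm 1%:E J (fun t => iQ (p t - ph h t)%R))%E in
  let best h := (best_approx J (Vh h) u + best_approx J (Qh h) p)%E in
  let r h := approx_rate jV J (Vh h) in
  let n h := approx_rate jQ J (Qh h) in
  (exists C : R, forall h, H h -> (err h <= C%:E * best h * (r h + n h))%E) /\
  ((exists C' : R, forall h, H h -> (r h + n h <= (C' * h)%:E)%E) ->
   exists C : R, forall h, H h -> (err h <= (C * h)%:E * best h)%E).
Proof.
move=> J err best r n.
have [ciV ciV0 iVC] := linear_bounded hiV.2.
have [ciQ ciQ0 iQC] := linear_bounded hiQ.2.
have mJ : measurable (`[0, T]%classic : set (measurableTypeR R)) by [].
have norm1_ge0 (X : normedModType R) (x : R -> X) : (0 <= bochner_norm 1%:E J x)%E.
  exact: Lnorm_ge0.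
have best_ge0 h : (0 <= best h)%E.
  by apply: adde_ge0; apply: le_ereal_inf_tmp => _ [x _ <-]; exact: norm1_ge0.
have r_ge0 h : (0 <= r h)%E by rewrite /r /approx_rate le_max lexx.
have n_ge0 h : (0 <= n h)%E by rewrite /n /approx_rate le_max lexx.
suff [C C0 hC] : exists2 C : R, 0 <= C &
    forall h, H h -> (err h <= C%:E * best h * (r h + n h))%E.
  split; first by exists C.
  move=> [C' hC']; exists (C * C') => h Hh; apply: le_trans (hC h Hh) _.
  rewrite -mulrA EFinM [leRHS]muleAC; apply: lee_wpmul2l; last exact: hC'.
  by rewrite mule_ge0.
have errE h : err h =
    (bochner_norm 1%:E J (fun t => iV (u t - uh h t)%R) +
     bochner_norm 1%:E J (fun t => iQ (p t - ph h t)%R))%E by [].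
move: (T_ge0); rewrite le_eqVlt => /predU1P[T0|T0].
  exists 0 => // h Hh.
  have norm0 (X : normedModType R) (x : R -> X) : bochner_norm 1%:E J x = 0%E.
    rewrite (@integral_bochner_norm1 _ _ _ _ x); last exact: aeW.
    by rewrite /J -T0 set_itv1 integral_set1.
  by rewrite errE !norm0 adde0 !mul0e.
have [K1 K10 hqo] :=
  quasi_optimality hk1 hk2 a_cont b_cont T_ge0 alphas_gt0 betas_gt0 hV.
have [K2 K20 hde] := duality_estimate hk1 hk2 hk3 a_cont b_cont hjV.2 hjQ.2
  T0 hVm hQm hdual.
pose K1' := K1 + 1.
have K1'0 : 0 < K1' by rewrite ltr_wpDl.
exists (K2 * K1' + 1) => [|h Hh]; first by rewrite addr_ge0// mulr_ge0// ltW.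
have [V0 _] := fin_dim_subspaceP (hVh h Hh).
have [Q0 _] := fin_dim_subspaceP (hQh h Hh).
have [solh _] := huph h Hh; have [sol _] := hup.
have [e [eps [se seps ie ieps hE]]] :=
  galerkin_error hk1 hk2 hk3 a_cont b_cont V0 Q0 sol solh.
have [Lu Lp _] := sol; have [Luh Lph _] := solh.
have orth : {ae @lebesgue_measure R, forall t, J t ->
    forall q, Qh h q -> b (e t) q = 0}.
  apply: (constraint_error0 hk3 b_cont T_ge0 se ie).
  by apply: ae_imp hE => t hE Jt; have [] := hE Jt.
pose E : measurableTypeR R -> R := fun t => `|e t| + `|eps t|.
pose y : measurableTypeR R -> R := fun t => `|iV (e t)| + `|iQ (eps t)|.
have iE : (@lebesgue_measure R).-integrable J (EFin \o E).
  by apply: eq_integrable (integrableD _ ie ieps).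
have my1 : measurable_fun (J : set (measurableTypeR R))
    (fun t : measurableTypeR R => `|iV (e t)|).
  apply: (simple_limit_functional (l := fun v => `|iV v|)) => // v.
  by apply: continuous_comp; [exact: hiV.2|exact: norm_continuous].
have my2 : measurable_fun (J : set (measurableTypeR R))
    (fun t : measurableTypeR R => `|iQ (eps t)|).
  apply: (simple_limit_functional (l := fun v => `|iQ v|)) => // v.
  by apply: continuous_comp; [exact: hiQ.2|exact: norm_continuous].
pose ci := ciV + ciQ.
have yE t : y t <= ci * E t.
  have := iVC (e t); have := iQC (eps t) => h1 h2.
  rewrite (le_trans (lerD h2 h1))// -subr_ge0 /ci /E.
  rewrite (_ : _ - _ = ciV * `|eps t| + ciQ * `|e t|); last by ring.
  by rewrite addr_ge0// mulr_ge0.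
have y0 t : 0 <= y t by rewrite addr_ge0.
have E0 t : 0 <= E t by rewrite addr_ge0.
have ciE : (@lebesgue_measure R).-integrable J (EFin \o (fun t => ci * E t)).
  apply: (eq_integrable _ (fun t => ci%:E * (EFin \o E) t)%E) => //.
  exact: integrableZl.
have iy : (@lebesgue_measure R).-integrable J (EFin \o y).
  apply: (le_integrable _ _ _ ciE) => //.
    by apply/measurable_EFinP; exact: measurable_funD.
  by move=> t _; rewrite lee_fin ger0_norm// (le_trans (yE t))// ler_norm.
set A := \int[@lebesgue_measure R]_(t in J) E t.
have A0 : 0 <= A by exact: Rintegral_ge0.
have iy1 : (@lebesgue_measure R).-integrable J
    (fun t : measurableTypeR R => `|iV (e t)|%:E).
  apply: (le_integrable _ _ _ iy) => //; first exact/measurable_EFinP.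
  by move=> t _; rewrite lee_fin normr_id ger0_norm// lerDl.
have iy2 : (@lebesgue_measure R).-integrable J
    (fun t : measurableTypeR R => `|iQ (eps t)|%:E).
  apply: (le_integrable _ _ _ iy) => //; first exact/measurable_EFinP.
  by move=> t _; rewrite lee_fin normr_id ger0_norm// lerDr.
have err_y : err h = (\int[@lebesgue_measure R]_(t in J) y t)%:E.
  apply: bochner_norm1D => //.
    by apply: ae_imp hE => t hE /hE[-> _ _ _].
  by apply: ae_imp hE => t hE /hE[_ -> _ _].
have err_ciA : (err h <= (ci * A)%:E)%E.
  rewrite err_y lee_fin /A -RintegralZl//; exact: le_Rintegral.
have A_best : (A%:E <= K1'%:E * best h)%E.
  rewrite -lee_pdivrMl// -EFinM.
  apply: ereal_inf_add_ge => [_ [v _ <-]|_ [q _ <-]|_ _ [v Lv <-] [q Lq <-]] //.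
  rewrite EFinM lee_pdivrMl//.
  have [u' [su uE iu]] := Lp_bochner1_representative mJ Lu.
  have [p' [sp pE ip]] := Lp_bochner1_representative mJ Lp.
  have [v' [sv vE iv]] := Lp_bochner1_representative mJ Lv.
  have [q' [sq qE iq]] := Lp_bochner1_representative mJ Lq.
  rewrite (@bochner_norm1D _ _ _ _ _ (fun t => u' t - v' t) _ (fun t => p' t - q' t))//.
  - rewrite -EFinM lee_fin.
    apply: (@le_trans _ _ (K1 * \int[@lebesgue_measure R]_(t in J)
        (`|u' t - v' t| + `|p' t - q' t|))); last first.
      by rewrite ler_wpM2r ?lerDl// Rintegral_ge0.
    apply: (hqo _ _ (hVh h Hh) (hQh h Hh) (a_coercive_h h Hh) (b_inf_sup_h h Hh)) => //.
    + exact: integrable_normB.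
    + exact: integrable_normB.
    have [_ _ Vv] := Lv; have [_ _ Qq] := Lq.
    have [_ _ Vuh] := Luh; have [_ _ Qph] := Lph.
    apply: ae_imp (ae_and (ae_and (ae_and uE pE) (ae_and vE qE))
      (ae_and (ae_and orth hE) (ae_and (ae_and Vv Qq) (ae_and Vuh Qph)))) => t.
    move=> [[[ut pt] [vt qt]] [[ot Et] [[Vvt Qqt] [Vuht Qpht]]]] Jt.
    have [et epst eqt _] := Et Jt; split => //; first exact: ot.
      rewrite ut// vt// et opprB addrC addrA subrK.
      by apply: (fin_dim_subspaceB (hVh h Hh)); [exact: Vuht|exact: Vvt].
    rewrite pt// qt// epst opprB addrC addrA subrK.
    by apply: (fin_dim_subspaceB (hQh h Hh)); [exact: Qpht|exact: Qqt].
  - by apply: ae_imp (ae_and uE vE) => t [ut vt] Jt; rewrite ut// vt.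
  - by apply: ae_imp (ae_and pE qE) => t [ut vt] Jt; rewrite ut// vt.
  - exact: integrable_normB.
  - exact: integrable_normB.
(* an infinite rate gives nothing if [best h = 0]: there the error itself is zero *)
case: (eqVneq (r h + n h)%E +oo%E) => [rny|rny].
  have [b0|b0] := eqVneq (best h) 0%E.
    have A00 : A = 0.
      apply/eqP; rewrite eq_le A0 andbT -lee_fin.
      by rewrite (le_trans A_best)// b0 mule0.
    rewrite b0 mule0 mul0e; apply: le_trans err_ciA _.
    by rewrite A00 mulr0.
  have C1 : 0 < K2 * K1' + 1 by rewrite ltr_wpDl// mulr_ge0// ltW.
  have cb : (0 < (K2 * K1' + 1)%:E * best h)%E.
    by rewrite mule_gt0// ?lte_fin// lt0e b0 best_ge0.
  by rewrite rny gt0_muley// leey.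
have rn_lty : (r h + n h < +oo)%E by rewrite ltey.
have r_fin : r h \is a fin_num.
  by rewrite ge0_fin_numE// (le_lt_trans _ rn_lty)// leeDl.
have n_fin : n h \is a fin_num.
  by rewrite ge0_fin_numE// (le_lt_trans _ rn_lty)// leeDr.
have y_bound : \int[@lebesgue_measure R]_(t in J) y t <=
    K2 * (fine (r h) + fine (n h)) * A.
  apply: (hde _ _ _ _ V0 Q0) => //.
  - exact: fine_ge0.
  - exact: fine_ge0.
  - by rewrite fineK.
  - by rewrite fineK.
  apply: ae_imp (ae_and orth hE) => t [ot Et] Jt; have [_ _ eqt _] := Et Jt.
  by split=> //; exact: ot.
rewrite err_y; apply: (@le_trans _ _ (K2 * (fine (r h) + fine (n h)) * A)%:E).
  by rewrite lee_fin.
have -> : (K2 * (fine (r h) + fine (n h)) * A)%:E = (K2%:E * A%:E * (r h + n h))%E.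
  case: (r h) r_fin => [r'| |] // _; case: (n h) n_fin => [n'| |] // _.
  by rewrite /= -EFinD -!EFinM; congr (_%:E); ring.
apply: lee_wpmul2r; first exact: adde_ge0.
apply: (@le_trans _ _ (K2%:E * (K1'%:E * best h))%E).
  by apply: lee_wpmul2l.
rewrite muleA -EFinM; apply: lee_wpmul2r => //.
by rewrite lee_fin lerDl.
Qed.
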